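(* Let $X$ and $Y$ be bounded real random variables defined on the same probability space (not necessarily independent) with marginal laws $\nu_X$ and $\nu_Y$, respectively. Let $\{(X(i),Y(i))\}_{i=1}^\infty$ be an i.i.d. family of copies of the pair $(X,Y)$. For each positive integer $N$ let $X^{(N)}$ (resp. $Y^{(N)}$) be the $N$-by-$N$ diagonal random matrix with diagonal entries $X(1),\dots,X(N)$ (resp. $Y(1),\dots,Y(N)$), and let $H^{(N)}$ be a deterministic $N$-by-$N$ complex Hadamard matrix. Then the noncommutative random variables $$X^{(N)}\quad\text{and}\quad\frac1N H^{(N)}Y^{(N)}H^{(N)*}$$ are asymptotically free. In particular, the law of $$X^{(N)}+\frac1N H^{(N)}Y^{(N)}H^{(N)*}$$ converges in moments to $\nu_X\boxplus\nu_Y$, and (assuming $X^{(N)}$ has nonnegative entries for all $N$) the law of $$\frac1N(X^{(N)})^{1/2}H^{(N)}Y^{(N)}H^{(N)*}(X^{(N)})^{1/2}$$ converges in moments to $\nu_X\boxtimes\nu_Y$.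
   Context: An $N$-by-$N$ complex matrix $H$ is a complex Hadamard matrix if $H/\sqrt N$ is unitary and $|H(i,j)|=1$ for all $i,j$. Random matrices are regarded as noncommutative random variables in the noncommutative probability space consisting of (i) the algebra of $N$-by-$N$ random matrices with essentially bounded complex entries defined on the probability space where the sequence $\{(X(i),Y(i))\}_{i=1}^\infty$ is defined and (ii) the tracial state $A\mapsto\frac1N\mathbf{E}\,\mathrm{tr}\,A$, where $\mathrm{tr}$ is the unnormalized trace. A noncommutative probability space is a pair $(\mathcal{A},\phi)$ with $\mathcal{A}$ a unital complex algebra and $\phi:\mathcal{A}\to\mathbb{C}$ linear with $\phi(1_{\mathcal{A}})=1$ (a state). The joint law of a family $\{a_i\}_{i\in I}$ in $\mathcal{A}$ is the state $f\mapsto\phi(f(\{a_i\}_{i\in I}))$ on the noncommutative polynomial algebra $\mathbb{C}\langle\{\mathbf{X}_i\}_{i\in I}\rangle$. Unital subalgebras $\{\mathcal{A}_i\}_{i\in I}$ of $\mathcal{A}$ are free with respect to $\phi$ if $\phi(a_1\cdots a_\ell)=0$ whenever $\ell\ge2$, $i_1\ne i_2,\dots,i_{\ell-1}\ne i_\ell$, $a_j\in\mathcal{A}_{i_j}$ and $\phi(a_j)=0$ for all $j$; elements are free if the unital subalgebras they generate are. A sequence of families $\{a_i^{(N)}\}_{i\in I}$ (each in its own noncommutative probability space) is asymptotically free if the joint laws converge pointwise on $\mathbb{C}\langle\{\mathbf{X}_i\}_{i\in I}\rangle$ (convergence in moments) and $\{\mathbf{X}_i\}_{i\in I}$ is free with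 respect to the limit state. The law of a single noncommutative variable $a^{(N)}$ converges in moments to a compactly supported probability measure $\mu$ on $\mathbb{R}$ if its $k$-th moment $\phi^{(N)}((a^{(N)})^k)$ converges to $\int x^k\,d\mu$ for every integer $k\ge 0$. $\boxplus$ and $\boxtimes$ denote additive and multiplicative free convolution: if $a,b$ are free self-adjoint variables with laws $\mu,\nu$, then $\mu\boxplus\nu$ is the law of $a+b$, and, when $a\ge0$, $\mu\boxtimes\nu$ is the law of $a^{1/2}ba^{1/2}$. *)

(* Defs.v *)
From HB Require Import structures.
From mathcomp Require Import all_boot all_order all_algebra finmap complex.
From mathcomp Require Import all_classical all_reals all_analysis.
From mathcomp Require Import measurable_realfun ess_sup_inf.
From mathcomp Require monalg.
Import (canonicals, coercions) monalg.

Set Implicit Arguments.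
Unset Strict Implicit.
Unset Printing Implicit Defensive.

Import Order.TTheory GRing.Theory Num.Theory numFieldNormedType.Exports.

Local Open Scope classical_set_scope.
Local Open Scope ring_scope.
Local Open Scope sesquilinear_scope.
Local Open Scope complex_scope.

Section FunctionAlgebra.
Variables (T : pointedType) (K : comNzRingType) (A : algType K).

Fact fct_scalerAl (k : K) (f g : T -> A) : k *: (f * g) = (k *: f) * g.
Proof. by apply/funext => t; exact: scalerAl. Qed.

HB.instance Definition _ :=
  GRing.Lmodule_isLalgebra.Build K (T -> A) fct_scalerAl.

Fact fct_scalerAr (k : K) (f g : T -> A) : k *: (f * g) = f * (k *: g).
Proof. by apply/funext => t; exact: scalerAr. Qed.

HB.instance Definition _ :=
  GRing.Lalgebra_isAlgebra.Build K (T -> A) fct_scalerAr.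

End FunctionAlgebra.

Section NoncommutativePolynomials.
Variables (K : comNzRingType) (I : choiceType).

(* K<{X_i}_{i in I}>: the algebra of the free monoid on I, whose elements     *)
(* [monalg.fmonom I] are the words in I.                                      *)
Definition ncpoly := monalg.malg (monalg.fmonom I) K.

HB.instance Definition _ := GRing.Lalgebra.on ncpoly.

Fact ncpoly_scalerAr (k : K) (f g : ncpoly) : k *: (f * g) = f * (k *: g).
Proof.
rewrite (monalg.malgME f g) scaler_sumr.
have le2 : fsubset (monalg.msupp (k *: g)) (monalg.msupp g).
  exact: monalg.msuppZ_le.
rewrite (monalg.malgMEw (fsubset_refl _) le2).
apply: eq_bigr => k1 _; rewrite scaler_sumr; apply: eq_bigr => k2 _.
apply/monalg.malgP => w.
rewrite monalg.mcoeffZ !monalg.mcoeffU monalg.mcoeffZ.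
by rewrite mulrCA mulrnAr.
Qed.

HB.instance Definition _ :=
  GRing.Lalgebra_isAlgebra.Build K ncpoly ncpoly_scalerAr.

Definition ncX (i : I) : ncpoly := monalg.mkmalgU (monalg.fmu i) 1.

(* f({a_i}_{i in I}): a word i_1 ... i_l is sent to a_{i_1} * ... * a_{i_l}.  *)
Definition nceval (A : algType K) (a : I -> A) (f : ncpoly) : A :=
  monalg.mmap (@GRing.in_alg K A)
    (fun w : monalg.fmonom I => \prod_(i <- w) a i) f.

End NoncommutativePolynomials.

Section NoncommutativeProbability.
Variable R : realType.
Local Notation C := R[i].

(* A noncommutative probability space is a pair of an [A : algType C] and a   *)
(* [phi : ncstate A]; no positivity is required here.                         *)
Record ncstate (A : algType C) := NCState {
  ncstate_fun :> {scalar A};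
  ncstate1 : ncstate_fun 1 = 1 }.

Definition joint_law (A : algType C) (phi : ncstate A) (I : choiceType)
  (a : I -> A) : ncpoly C I -> C := fun f => phi (nceval a f).

(* The unital subalgebras [S i] are free.  A pair [(i, a)] of the list [s]    *)
(* stands for a factor [a] taken from [S i].                                  *)
Definition free_subalgebras (A : algType C) (phi : A -> C) (I : choiceType)
    (S : I -> set A) :=
  forall s : seq (I * A), (2 <= size s)%N ->
    sorted (fun x y => x.1 != y.1) s ->
    (forall x, x \in s -> S x.1 x.2 /\ phi x.2 = 0) ->
    phi (\prod_(x <- s) x.2) = 0.

Definition generated_subalgebra (A : algType C) (B : set A) : set A :=
  smallest (fun S : set A => GRing.subalg_closed (mem S)) B.

Definition free_elements (A : algType C) (phi : A -> C) (I : choiceType)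
    (a : I -> A) :=
  free_subalgebras phi (fun i => generated_subalgebra [set a i]).

Definition asymptotically_free (I : choiceType) (A : nat -> algType C)
    (phi : forall N, ncstate (A N)) (a : forall N, I -> A N) :=
  exists tau : ncstate (ncpoly C I),
    (forall f : ncpoly C I,
       (joint_law (phi N) (a N) f : C^o) @[N --> \oo] --> (tau f : C^o)) /\
    free_elements tau (@ncX C I).

Definition pair_family {A : Type} (a b : A) : bool -> A :=
  fun i => if i then a else b.

Definition moment (mu : probability R R) (k : nat) : R := \int[mu]_x (x ^+ k).

Definition compactly_supported (mu : probability R R) :=
  exists2 K : set R, compact K & mu (~` K) = 0%E.

Definition converges_in_moments (A : nat -> algType C)
    (phi : forall N, ncstate (A N)) (a : forall N, A N)
    (mu : probability R R) :=
  compactly_supported mu /\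
  forall k : nat,
    (phi N (a N ^+ k) : C^o) @[N --> \oo] --> ((moment mu k)%:C : C^o).

End NoncommutativeProbability.

Section FreeConvolution.
Variable R : realType.
Local Notation C := R[i].

Definition is_star (A : algType C) (st : A -> A) :=
  [/\ involutive st,
      {morph st : a b / a + b},
      forall (z : C) a, st (z *: a) = z^* *: st a &
      forall a b, st (a * b) = st b * st a].

Definition positive_state (A : algType C) (st : A -> A) (phi : A -> C) :=
  forall a, 0 <= phi (st a * a).

Definition tracial (A : algType C) (phi : A -> C) :=
  forall a b, phi (a * b) = phi (b * a).

Definition self_adjoint (A : algType C) (st : A -> A) (a : A) := st a = a.

(* The law of [a] is the compactly supported measure [mu].                    *)
Definition has_law (A : algType C) (phi : A -> C) (a : A)
    (mu : probability R R) :=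
  compactly_supported mu /\ forall k : nat, phi (a ^+ k) = (moment mu k)%:C.

(* [s] is a^{1/2}: it squares to [a], and it is positive, i.e., of the form   *)
(* c^* c.  In particular, [a] = s^* s is then positive as well.               *)
Definition is_sqrt (A : algType C) (st : A -> A) (a s : A) :=
  (exists c, s = st c * c) /\ a = s * s.

Definition free_add_law (mu nu rho : probability R R) :=
  exists (A : algType C) (st : A -> A) (phi : ncstate A) (a b : A),
    [/\ is_star st, positive_state st phi,
        self_adjoint st a /\ self_adjoint st b,
        free_elements phi (pair_family a b) &
        [/\ has_law phi a mu, has_law phi b nu & has_law phi (a + b) rho]].

(* Traciality makes the law of s * b * s depend only on the laws of [a] and   *)
(* [b], whatever the square root [s] of [a] in [A].                           *)
Definition free_mul_law (mu nu rho : probability R R) :=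
  exists (A : algType C) (st : A -> A) (phi : ncstate A) (a b s : A),
    [/\ is_star st, positive_state st phi /\ tracial phi,
        self_adjoint st b /\ is_sqrt st a s,
        free_elements phi (pair_family a b) &
        [/\ has_law phi a mu, has_law phi b nu & has_law phi (s * b * s) rho]].

(* The law of [a + b] (resp. of a^{1/2} b a^{1/2}) is determined by [mu] and  *)
(* [nu].  The Dirac mass is a dummy value, for instance for a [mu] or a [nu]  *)
(* that is not compactly supported.                                           *)
Definition free_add_conv (mu nu : probability R R) : probability R R :=
  xget (\d_(0 : R) : probability R R) [set rho | free_add_law mu nu rho].

Definition free_mul_conv (mu nu : probability R R) : probability R R :=
  xget (\d_(0 : R) : probability R R) [set rho | free_mul_law mu nu rho].

End FreeConvolution.

Section EssentiallyBounded.
Context d (T : measurableType d) (R : realType) (P : probability T R).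
Local Notation C := R[i].
Local Notation Linf := (Lfun P +oo%E).

(* [f \in Lfun P +oo] means that [f] is measurable and essentially bounded. *)
Lemma LinfP (f : T -> R) : f \in Linf <->
  measurable_fun setT f /\ exists M : R, \forall t \ae P, `|f t| <= M.
Proof.
have P0 : (0 < P [set: T])%E by rewrite probability_setT.
split.
- move=> fL; split; first exact: set_mem (sub_Lfun_mfun fL).
  have := sub_Lfun_finLfun fL; rewrite inE/= /finite_norm unlock P0 => sf.
  by have [M MP] := ess_supr_bounded sf; exists M.
- move=> [mf [M fM]]; rewrite inE/=; apply/andP; split; rewrite inE//=.
  rewrite /finite_norm unlock P0; apply: (@le_lt_trans _ _ M%:E).
    by apply/ess_supP; apply: filterS fM => t; rewrite /= lee_fin.
  by rewrite ltry.
Qed.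

Lemma Linf_integrable (f : T -> R) :
  f \in Linf -> P.-integrable setT (EFin \o f).
Proof.
move=> fL; apply/Lfun1_integrable; move: f fL.
by apply: Lfun_subset => //; rewrite ?leey//; exact: fin_num_measure.
Qed.

Lemma Linf_cst (c : R) : cst c \in Linf.
Proof. by apply/LinfP; split => //; exists `|c|; apply: nearW. Qed.

Lemma LinfD (f g : T -> R) : f \in Linf -> g \in Linf -> f \+ g \in Linf.
Proof.
move=> /LinfP[mf [M fM]] /LinfP[mg [N gN]]; apply/LinfP; split.
  exact: measurable_funD.
exists (M + N); near=> t; rewrite (le_trans (ler_normD _ _))// lerD//.
- by near: t.
- by near: t.
Unshelve. all: by end_near. Qed.

Lemma LinfM (f g : T -> R) : f \in Linf -> g \in Linf -> f \* g \in Linf.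
Proof.
move=> /LinfP[mf [M fM]] /LinfP[mg [N gN]]; apply/LinfP; split.
  exact: measurable_funM.
exists (M * N); near=> t; rewrite /= normrM ler_pM//.
- by near: t.
- by near: t.
Unshelve. all: by end_near. Qed.

Lemma LinfN (f : T -> R) : f \in Linf -> \- f \in Linf.
Proof.
move=> /LinfP[mf [M fM]]; apply/LinfP; split; first exact: measurable_funN.
by exists M; apply: filterS fM => t; rewrite /= normrN.
Qed.

Lemma Linf_sqrt (f : T -> R) : f \in Linf -> Num.sqrt \o f \in Linf.
Proof.
move=> /LinfP[mf [M fM]]; apply/LinfP; split.
  by apply: measurableT_comp mf; apply: continuous_measurable_fun;
    exact: sqrt_continuous.
exists (Num.sqrt M); apply: filterS fM => t ftM.
by rewrite /= ger0_norm ?sqrtr_ge0// ler_wsqrtr// (le_trans (ler_norm _)).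
Qed.

Definition cLinf (f : T -> C) : bool :=
  ((fun t => complex.Re (f t)) \in Linf) &&
  ((fun t => complex.Im (f t)) \in Linf).

Lemma cLinf_cst (z : C) : cLinf (fun=> z).
Proof. by apply/andP; split; exact: Linf_cst. Qed.

Lemma cLinfD (f g : T -> C) : cLinf f -> cLinf g -> cLinf (fun t => f t + g t).
Proof.
move=> /andP[f1 f2] /andP[g1 g2]; apply/andP; split.
- rewrite (_ : (fun _ => _) =
    (fun t => complex.Re (f t)) \+ (fun t => complex.Re (g t))).
    exact: LinfD.
  by apply/funext => t /=; case: (f t) => ? ?; case: (g t).
- rewrite (_ : (fun _ => _) =
    (fun t => complex.Im (f t)) \+ (fun t => complex.Im (g t))).
    exact: LinfD.
  by apply/funext => t /=; case: (f t) => ? ?; case: (g t).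
Qed.

Lemma cLinfM (f g : T -> C) : cLinf f -> cLinf g -> cLinf (fun t => f t * g t).
Proof.
move=> /andP[f1 f2] /andP[g1 g2]; apply/andP; split.
- rewrite (_ : (fun _ => _) =
    ((fun t => complex.Re (f t)) \* (fun t => complex.Re (g t))) \+
    (\- ((fun t => complex.Im (f t)) \* (fun t => complex.Im (g t))))).
    by apply: LinfD; [|apply: LinfN]; exact: LinfM.
  by apply/funext => t /=; case: (f t) => ? ?; case: (g t).
- rewrite (_ : (fun _ => _) =
    ((fun t => complex.Re (f t)) \* (fun t => complex.Im (g t))) \+
    ((fun t => complex.Im (f t)) \* (fun t => complex.Re (g t)))).
    by apply: LinfD; exact: LinfM.
  by apply/funext => t /=; case: (f t) => ? ?; case: (g t).
Qed.

Lemma cLinf_sum (I : Type) (r : seq I) (F : I -> T -> C) :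
  (forall i, cLinf (F i)) -> cLinf (fun t => \sum_(i <- r) F i t).
Proof.
move=> FL; elim: r => [|i r IHr].
  by under eq_fun do rewrite big_nil; exact: cLinf_cst.
by under eq_fun do rewrite big_cons; exact: cLinfD.
Qed.

Lemma cLinf_real (f : T -> R) : f \in Linf -> cLinf (fun t => (f t)%:C).
Proof. by move=> fL; apply/andP; split => //; exact: Linf_cst. Qed.

Definition cexpectation (f : T -> C) : C :=
  (\int[P]_t complex.Re (f t)) +i* (\int[P]_t complex.Im (f t)).

Lemma cexpectationD (f g : T -> C) : cLinf f -> cLinf g ->
  cexpectation (fun t => f t + g t) = cexpectation f + cexpectation g.
Proof.
move=> /andP[f1 f2] /andP[g1 g2]; rewrite /cexpectation.
have -> : (fun t => complex.Re (f t + g t)) =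
    (fun t => complex.Re (f t) + complex.Re (g t)).
  by apply/funext => t; case: (f t) => ? ?; case: (g t).
have -> : (fun t => complex.Im (f t + g t)) =
    (fun t => complex.Im (f t) + complex.Im (g t)).
  by apply/funext => t; case: (f t) => ? ?; case: (g t).
by rewrite !RintegralD//; exact: Linf_integrable.
Qed.

Lemma cexpectationZ (z : C) (f : T -> C) : cLinf f ->
  cexpectation (fun t => z * f t) = z * cexpectation f.
Proof.
case: z => a b /andP[f1 f2]; rewrite /cexpectation.
have i1 := Linf_integrable f1; have i2 := Linf_integrable f2.
have iZ (c : R) (g : T -> R) : P.-integrable setT (EFin \o g) ->
    P.-integrable setT (EFin \o (fun t => c * g t)).
  move=> ig; rewrite (_ : _ \o _ = (fun t => c%:E * (EFin \o g) t)%E)//.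
  exact: integrableZl.
have -> : (fun t => complex.Re ((a +i* b) * f t)) =
    (fun t => a * complex.Re (f t) - b * complex.Im (f t)).
  by apply/funext => t; case: (f t).
have -> : (fun t => complex.Im ((a +i* b) * f t)) =
    (fun t => a * complex.Im (f t) + b * complex.Re (f t)).
  by apply/funext => t; case: (f t).
rewrite RintegralB//; [|exact: iZ..].
rewrite RintegralD//; [|exact: iZ..].
by rewrite !RintegralZl.
Qed.

End EssentiallyBounded.

(* The algebra [rmx P n] of (n+1)-by-(n+1) random matrices with essentially   *)
(* bounded complex entries, as a subalgebra of the functions from [T] to      *)
(* matrices (almost surely equal matrices are not identified), together with  *)
(* the tracial state A |-> E (tr A) / (n+1).                                  *)
Section RandomMatrices.
Context d (T : measurableType d) (R : realType) (P : probability T R).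
Variable n : nat.
Local Notation C := R[i].

Definition rmx_pred : {pred T -> 'M[C]_n.+1} := fun A =>
  [forall i, forall j, cLinf P (fun t => A t i j)].

Lemma rmx_predP (A : T -> 'M[C]_n.+1) : reflect (forall i j, cLinf P (fun t => A t i j))
  (A \in rmx_pred).
Proof.
apply: (iffP forallP) => [AL i j|AL i]; first exact: (forallP (AL i)).
by apply/forallP.
Qed.

Lemma rmx_subalg : GRing.subalg_closed rmx_pred.
Proof.
split=> [|z A B /rmx_predP AL /rmx_predP BL|A B /rmx_predP AL /rmx_predP BL];
  apply/rmx_predP => i j.
- exact: cLinf_cst.
- rewrite (_ : (fun _ => _) = (fun t => z * A t i j + B t i j)).
    by apply: cLinfD => //; apply: cLinfM => //; exact: cLinf_cst.
  by apply/funext => t; rewrite !mxE.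
- rewrite (_ : (fun _ => _) = (fun t => \sum_k A t i k * B t k j)).
    by apply: cLinf_sum => k; exact: cLinfM.
  by apply/funext => t; rewrite !mxE.
Qed.

HB.instance Definition _ := GRing.isSubalgClosed.Build C (T -> 'M[C]_n.+1)
  rmx_pred rmx_subalg.

Record rmx := Rmx {
  rmx_fun :> T -> 'M[C]_n.+1;
  rmx_funP : rmx_fun \in rmx_pred }.

HB.instance Definition _ := [isSub for rmx_fun].
HB.instance Definition _ := [Choice of rmx by <:].
HB.instance Definition _ := [SubChoice_isSubAlgebra of rmx by <:].

Lemma rmx_trace_Linf (A : rmx) : cLinf P (fun t => \tr (A t)).
Proof. by apply: cLinf_sum => i; apply/rmx_predP/rmx_funP. Qed.

Definition rmx_phi (A : rmx) : C :=
  n.+1%:R^-1 * cexpectation P (fun t => \tr (A t)).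

Lemma rmx_phi_is_scalar : scalar rmx_phi.
Proof.
move=> z A B; rewrite /rmx_phi.
have -> : (fun t => \tr ((z *: A + B : rmx) t)) =
    (fun t => z * \tr (A t) + \tr (B t)).
  by apply/funext => t; rewrite /= mxtraceD mxtraceZ.
have [AL BL] := (rmx_trace_Linf A, rmx_trace_Linf B).
have zAL : cLinf P (fun t => z * \tr (A t)).
  by apply: cLinfM => //; exact: cLinf_cst.
by rewrite cexpectationD// cexpectationZ// mulrDr mulrCA.
Qed.

HB.instance Definition _ := GRing.isLinear.Build C rmx C _ rmx_phi
  rmx_phi_is_scalar.

Lemma rmx_phi1 : rmx_phi 1 = 1.
Proof.
rewrite /rmx_phi.
have -> : (fun t => \tr ((1 : rmx) t)) = cst n.+1%:R.
  by apply/funext => t; rewrite /= mxtrace1.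
have E1 (c : R) : \int[P]_t (cst c t) = c.
  rewrite Rintegral_cst// (_ : fine _ = 1) ?mulr1//.
  by have := probability_setT P; move=> /= ->.
rewrite /cexpectation (_ : _ +i* _ = (n.+1%:R : C)) ?mulVf ?pnatr_eq0//.
by rewrite /= !E1; case: (n.+1%:R).
Qed.

Definition rmx_state : ncstate rmx := NCState rmx_phi1.

Fact rmx_cst_subproof (M : 'M[C]_n.+1) : (fun=> M) \in rmx_pred.
Proof. by apply/rmx_predP => i j; exact: cLinf_cst. Qed.

Definition rmx_cst (M : 'M[C]_n.+1) : rmx := Rmx (rmx_cst_subproof M).

Fact rmx_diag_subproof (Z : nat -> T -> R) :
    (forall i, Z i \in Lfun P +oo%E) ->
  (fun t => diag_mx (\row_(i < n.+1) (Z i t)%:C)) \in rmx_pred.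
Proof.
move=> ZL; apply/rmx_predP => i j.
under eq_fun do rewrite !mxE.
case: eqP => _; last exact: cLinf_cst.
by under eq_fun do rewrite mulr1n; exact: cLinf_real.
Qed.

(* The random diagonal matrix with diagonal entries Z_0, ..., Z_n. *)
Definition rmx_diag (Z : nat -> T -> R)
    (ZL : forall i, Z i \in Lfun P +oo%E) : rmx :=
  Rmx (rmx_diag_subproof ZL).

End RandomMatrices.

(* The pairs (Xs i, Ys i), i : nat, are i.i.d. copies of (X, Y): they have    *)
(* the joint law of (X, Y), which need not be a product, and every finite     *)
(* subfamily of pairs is independent.                                         *)
Section IIDCopies.
Context d0 (T0 : measurableType d0) d (T : measurableType d) (R : realType).
Variables (P0 : probability T0 R) (P : probability T R).

Definition rv_pair {S : Type} (X Y : S -> R) (t : S) : R * R := (X t, Y t).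

Definition pair_copies (X Y : T0 -> R) (Xs Ys : nat -> T -> R) :=
  forall i (B : set (R * R)), measurable B ->
    P (rv_pair (Xs i) (Ys i) @^-1` B) = P0 (rv_pair X Y @^-1` B).

Definition pair_independent (Xs Ys : nat -> T -> R) :=
  forall (J : {fset nat}) (B : nat -> set (R * R)),
    (forall i, measurable (B i)) ->
    P (\bigcap_(i in [set` J]) (rv_pair (Xs i) (Ys i) @^-1` B i)) =
    (\prod_(i <- J) P (rv_pair (Xs i) (Ys i) @^-1` B i))%E.

Variables (X Y : {RV P0 >-> R}) (Xs Ys : nat -> {RV P >-> R}).
Hypothesis XYcopies : pair_copies X Y Xs Ys.

Lemma copies_Linf (U : {RV P0 >-> R}) (V : {RV P >-> R}) :
  (forall B : set R, measurable B -> P (V @^-1` B) = P0 (U @^-1` B)) ->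
  (U : T0 -> R) \in Lfun P0 +oo%E -> (V : T -> R) \in Lfun P +oo%E.
Proof.
move=> UV /LinfP[_ [M UM]]; apply/LinfP; split; first exact: measurable_funPT.
have mB : measurable (~` `[- M, M] : set R) by exact: measurableC.
have eB S (F : S -> R) :
    ~` [set t | `|F t| <= M] = F @^-1` (~` `[- M, M]).
  by apply/seteqP; split => t /=; rewrite in_itv/= ler_norml.
have mUB : measurable (U @^-1` (~` `[- M, M])).
  by rewrite -[_ @^-1` _]setTI; exact: measurable_funPT.
have mVB : measurable (V @^-1` (~` `[- M, M])).
  by rewrite -[_ @^-1` _]setTI; exact: measurable_funPT.
have P0U : P0 (U @^-1` (~` `[- M, M])) = 0%E.
  by apply/(negligibleP _ mUB); rewrite -eB; exact: UM.
exists M; suff : P.-negligible (~` [set t | `|V t| <= M]) by [].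
by rewrite eB; apply/(negligibleP _ mVB); rewrite -P0U; exact: UV.
Qed.

Lemma copies_Linf1 : (X : T0 -> R) \in Lfun P0 +oo%E ->
  forall i, (Xs i : T -> R) \in Lfun P +oo%E.
Proof.
move=> XL i; apply: copies_Linf XL => B mB.
have := XYcopies i (measurableX mB (@measurableT _ R)).
have eB S (F G : S -> R) : rv_pair F G @^-1` (B `*` setT) = F @^-1` B.
  by apply/seteqP; split => t; [case|].
by rewrite !eB.
Qed.

Lemma copies_Linf2 : (Y : T0 -> R) \in Lfun P0 +oo%E ->
  forall i, (Ys i : T -> R) \in Lfun P +oo%E.
Proof.
move=> YL i; apply: copies_Linf YL => B mB.
have := XYcopies i (measurableX (@measurableT _ R) mB).
have eB S (F G : S -> R) : rv_pair F G @^-1` (setT `*` B) = G @^-1` B.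
  by apply/seteqP; split => t; [case|].
by rewrite !eB.
Qed.

End IIDCopies.

Section Hadamard.
Variable R : realType.
Local Notation C := R[i].

Definition complex_hadamard (n : nat) (H : 'M[C]_n) :=
  (Num.sqrt n%:R)%:C^-1 *: H \is unitarymx /\ forall i j, `|H i j| = 1.

End Hadamard.

(* Main.v *)
(* Freeness of a family of elements reduces to the
   vanishing of alternating products of centered powers.  The trace of such a
   product of diagonal matrices and conjugates by H is, after a cyclic rotation,
   N^(-l) times a sum over index maps from 2l positions to N points, with
   weights of modulus 1; here at most one factor (the one that merges the two
   ends of an odd word) is not centered.  Independence kills every index map
   that takes some value only once at a centered position, and the O(N^l)
   remaining ones contribute O(1/N) to the normalized trace.

   Alternating products of centered powers and 1 span the noncommutative
   polynomials, so the joint moments converge, to a state which is tracial and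
   positive, being a limit of such.  The additive and multiplicative free
   convolutions are then realized by this very limit state, the law of a bounded
   self-adjoint element being produced by the Hausdorff moment problem.  In the
   multiplicative case the argument is run with the fourth root of X. *)

Require Import Defs.
From HB Require Import structures.
From mathcomp Require Import all_boot all_order all_algebra finmap complex.
From mathcomp Require Import all_classical all_reals all_analysis.
From mathcomp Require Import measurable_realfun.
From mathcomp Require monalg.
From mathcomp Require Import zify ring lra.
Import (canonicals, coercions) monalg.

Import Order.TTheory GRing.Theory Num.Theory numFieldNormedType.Exports.

Set Implicit Arguments.
Unset Strict Implicit.
Unset Printing Implicit Defensive.

Local Open Scope classical_set_scope.
Local Open Scope ring_scope.
Local Open Scope sesquilinear_scope.
Local Open Scope complex_scope.

(** * Noncommutative polynomials and freeness *)

(** The free convolutions are defined by selecting any measure realized by free variables in some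
    space. Two facts are therefore owed: a realization exists, and every realization has the moments
    found in the limit. The second holds because freeness determines a joint law from the individual
    moments. For the first, the limit space already contains free variables with the right laws;
    what remains is a measure for their sum or product, obtained from the positivity of [K + a] and
    [K - a] under the limit state.

    The fourth root has an algebraic origin. The square root s of a must have the form c^* c inside
    the algebra itself. If the self-adjoint generator x stands for the fourth root of X, then s =
    x^* x and a = s s = x^4 are polynomials.

    Since X(i) and Y(i) may be dependent, an index shared by a diagonal factor and a conjugated one
    counts as repeated, exactly like an index shared by two factors of the same kind. The count of
    index maps is insensitive to this distinction, which is why no independence within a pair is
    involved. *)

Section Evaluation.
Variables (K : comNzRingType) (I : choiceType).
Local Notation word := (monalg.fmonom I).
Local Notation ncpoly := (ncpoly K I).

Lemma nceval_linear (A : algType K) (a : I -> A) : linear (nceval a).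
Proof.
move=> c f g; rewrite /nceval raddfD /=; congr (_ + _).
rewrite (monalg.mmapEw (monalg.msuppZ_le _ _)) monalg.mmapE scaler_sumr.
by apply: eq_bigr => w _; rewrite monalg.mcoeffZ /= -!scalerAl mul1r scalerA.
Qed.

Lemma nceval_monoid_morphism (A : algType K) (a : I -> A) :
  monoid_morphism (nceval a).
Proof.
split.
  rewrite /nceval /GRing.one /= /monalg.fgone monalg.mmapU /= scale1r mul1r.
  by rewrite monalg.fm1 big_nil.
move=> f g; rewrite /nceval monalg.malgME raddf_sum mulr_suml /=.
apply: eq_bigr => u _; rewrite raddf_sum mulr_sumr /=; apply: eq_bigr => v _.
rewrite monalg.mmapU /= monalg.fmM big_cat /=.
by rewrite -!scalerAl -!scalerAr !mul1r scalerA mulrC.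
Qed.

HB.instance Definition _ (A : algType K) (a : I -> A) :=
  GRing.isLinear.Build K ncpoly A _ (nceval a) (nceval_linear a).
HB.instance Definition _ (A : algType K) (a : I -> A) :=
  GRing.isMonoidMorphism.Build ncpoly A (nceval a) (nceval_monoid_morphism a).

Lemma ncevalX (A : algType K) (a : I -> A) i : nceval a (ncX K i) = a i.
Proof.
rewrite /nceval monalg.mmapU /= scale1r mul1r monalg.fmU.
by rewrite big_seq1.
Qed.

Lemma ncpoly_word (w : word) :
  (monalg.mkmalgU w 1 : ncpoly) = \prod_(i <- w) ncX K i.
Proof.
case: w => w; elim: w => [|i w IHw] /=.
  by rewrite big_nil; congr monalg.mkmalgU; rewrite -monalg.fmoneE.
rewrite big_cons -IHw /ncX.
rewrite monalg.malgM_def monalg.fgmulUU mulr1; congr monalg.mkmalgU.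
by rewrite monalg.fmuE; exact/esym/monalg.fmmulE.
Qed.

Lemma ncpoly_ind (S : set ncpoly) :
  (forall c f g, S f -> S g -> S (c *: f + g)) ->
  (forall w : seq I, S (\prod_(i <- w) ncX K i)) -> forall f, S f.
Proof.
move=> Slin Sw f; rewrite (monalg.monalgE f).
have S0 : S 0.
  have := Slin (-1) _ _ (Sw [::]) (Sw [::]).
  by rewrite scaleN1r addNr.
elim/big_rec : _ => // w g _ Sg.
have -> : monalg.mkmalgU w (monalg.mcoeff w f) =
    monalg.mcoeff w f *: (monalg.mkmalgU w 1 : ncpoly).
  apply/monalg.malgP => k; rewrite monalg.mcoeffZ !monalg.mcoeffU.
  by rewrite mulrnAr mulr1.
by apply: Slin => //; rewrite ncpoly_word.
Qed.

End Evaluation.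

Lemma unsortedP (T : eqType) (e : rel T) (s : seq T) : ~~ sorted e s ->
  exists p x y q, s = p ++ [:: x, y & q] /\ ~~ e x y.
Proof.
elim: s => // x [//|y s] IH /=; rewrite negb_and => /orP[exy|/IH].
  by exists [::], x, y, s.
by move=> [p [u [v [q [-> euv]]]]]; exists (x :: p), u, v, q.
Qed.

Section AlternatingProducts.
Variables (K : comNzRingType) (I : choiceType).
Local Notation ncpoly := (ncpoly K I).

(* The constants [x.2] are arbitrary: changing one of them only adds a shorter
   product, so that one may switch between centering and merging factors. *)
Let shifted (s : seq (I * nat * K)) : ncpoly :=
  \prod_(x <- s) (ncX K x.1.1 ^+ x.1.2 - x.2%:A).

(** When [m] gives the moments of the letters, this reduces a linear property to the products on
    which freeness prescribes the state. Words are the products with all constants 0, and the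
    induction is on the number of factors. *)
Lemma ncpoly_alternating_ind (m : I -> nat -> K) (S : set ncpoly) :
  (forall c f g, S f -> S g -> S (c *: f + g)) ->
  (forall s : seq (I * nat), sorted (fun x y => x.1 != y.1) s ->
    S (\prod_(x <- s) (ncX K x.1 ^+ x.2 - (m x.1 x.2)%:A))) ->
  forall f, S f.
Proof.
move=> Slin Salt; apply: ncpoly_ind => // w.
suff SP n s : (size s <= n)%N -> S (shifted s).
  have := SP _ [seq (i, 1, 0) | i <- w] (leqnn _); rewrite /shifted big_map.
  by under eq_bigr do rewrite /= expr1 scale0r subr0.
elim: n s => [[|//] _|n IHn s].
  by rewrite /shifted big_nil; have := Salt [::] isT; rewrite big_nil.
rewrite leq_eqVlt => /predU1P[sn|]; last exact: IHn.
(* Constants are replaced from left to right, [p] being the part already treated; each replacement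
   costs a multiple of a product with one factor less. *)
have change : forall s1 s2 p, (size p + size s1 = n.+1)%N ->
    [seq x.1 | x <- s1] = [seq x.1 | x <- s2] ->
    S (shifted (p ++ s1)) -> S (shifted (p ++ s2)).
  elim=> [|x s1 IHs] [|y s2] p //= pn [xy s12] Sp.
  rewrite -cat_rcons; apply: (IHs s2) => //.
    by rewrite size_rcons addSnnS.
  have -> : shifted (rcons p y ++ s1) =
      (x.2 - y.2) *: shifted (p ++ s1) + shifted (p ++ x :: s1).
    rewrite cat_rcons /shifted !big_cat /= !big_cons xy.
    set F := \prod_(i <- p) _; set G := \prod_(i <- s1) _.
    rewrite scalerAr -mulrDr; congr (_ * _).
    rewrite -[_ *: G]mulr_algl -mulrDl; congr (_ * _).
    by rewrite scalerBl [RHS]addrC addrA subrK.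
  apply: Slin => //; apply: IHn; rewrite size_cat.
  by rewrite -ltnS -pn addnS.
have [s_alt|] := boolP (sorted (fun x y : I * nat => x.1 != y.1)
    [seq x.1 | x <- s]).
  apply: (change [seq (x.1, m x.1.1 x.1.2) | x <- s] s [::]).
  - by rewrite size_map.
  - by rewrite -map_comp.
  - have := Salt _ s_alt; rewrite /shifted /= !big_map.
    by under eq_bigr do idtac.
(* Two neighbours share their letter: with all constants set to 0 they merge into one power, which
   shortens the product. *)
move=> /unsortedP[p [x [y [q [sE /negPn/eqP xy]]]]].
apply: (change [seq (x, 0) | x <- p ++ [:: x, y & q]] s [::]).
- by rewrite size_map -sE size_map.
- by rewrite sE -map_comp map_id_in.
have := IHn [seq (x, 0) | x <- p ++ (x.1, (x.2 + y.2)%N) :: q].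
rewrite size_map size_cat /= addnS -ltnS -sn.
have -> : size s = (size p + (size q).+2)%N.
  by rewrite -(size_map fst) sE size_cat.
rewrite !addnS => /(_ (leqnn _)); rewrite /shifted !big_map !big_cat /=.
by rewrite !big_cons /= !scale0r !subr0 exprD xy !mulrA.
Qed.

End AlternatingProducts.

(** * Freeness tested on centered powers *)

Section Freeness.
Variable R : realType.
Local Notation C := R[i].

Lemma generated_subalgebraP (A : algType C) (a x : A) :
  generated_subalgebra [set a] x <-> exists p : {poly C}, x = horner_alg a p.
Proof.
split=> [|[p ->]].
  move=> /(_ [set y | exists p, y = horner_alg a p]); apply.
  split=> [|_ ->]; last by exists 'X; rewrite /= horner_algX.
  split=> [|c u v|u v]; rewrite !inE /=.
  - by exists 1; rewrite rmorph1.
  - move=> [p ->] [q ->]; exists (c *: p + q).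
    by rewrite linearP /= mulr_algl.
  - by move=> [p ->] [q ->]; exists (p * q); rewrite rmorphM.
move=> S [[S1 SL SM] /(_ a erefl) Sa].
have S1' : S 1 by rewrite -inE.
have {}SL c u v : S u -> S v -> S (c *: u + v).
  by move=> Su Sv; have := SL c u v; rewrite !inE; apply.
have {}SM u v : S u -> S v -> S (u * v).
  by move=> Su Sv; have := SM u v; rewrite !inE; apply.
have S0 : S 0 by have := SL (-1) _ _ S1' S1'; rewrite scaleN1r addNr.
elim/poly_ind : p => [|p c Sp]; first by rewrite linear0.
rewrite linearD rmorphM /= horner_algX horner_algC addrC.
by apply: SL => //; exact: SM.
Qed.

Lemma ncstateB_cst (A : algType C) (phi : ncstate A) (a : A) (c : C) :
  phi (a - c%:A) = phi a - c.
Proof.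
rewrite linearB; congr (_ - _).
by rewrite -[RHS]mulr1 -(ncstate1 phi) -[RHS]/(c *: _) -linearZ.
Qed.

(** A subalgebra with one generator consists of polynomials in it, so its elements of mean zero are
    combinations of centered powers; multilinearity does the rest. *)
Lemma free_elementsP (I : choiceType) (A : algType C) (phi : ncstate A)
    (a : I -> A) :
  free_elements phi a <->
  forall s : seq (I * nat), (2 <= size s)%N ->
    sorted (fun x y => x.1 != y.1) s ->
    phi (\prod_(x <- s) (a x.1 ^+ x.2 - (phi (a x.1 ^+ x.2))%:A)) = 0.
Proof.
have phiZ c u : phi (c *: u) = c * phi u by rewrite linearZ.
have centered i k : phi (a i ^+ k - (phi (a i ^+ k))%:A) = 0.
  by rewrite ncstateB_cst subrr.
split=> [phi_free s s2 s_alt|phi0 s s2 s_alt sP].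
  have := phi_free
    [seq (x.1, a x.1 ^+ x.2 - (phi (a x.1 ^+ x.2))%:A) | x <- s].
  rewrite size_map big_map; apply=> //; first by rewrite sorted_map.
  move=> _ /mapP[[i k] _ ->] /=; split => //.
  apply/generated_subalgebraP; exists ('X^k - (phi (a i ^+ k))%:P).
  by rewrite rmorphB rmorphXn /= horner_algX horner_algC.
(* The prefix [p] is already expanded into centered powers, while [s] still holds arbitrary elements
   of mean zero. *)
suff phis p : (2 <= size p + size s)%N ->
    sorted (fun i j : I => i != j) (map fst p ++ map fst s) ->
    phi (\prod_(x <- p) (a x.1 ^+ x.2 - (phi (a x.1 ^+ x.2))%:A) *
         \prod_(x <- s) x.2) = 0.
  by have := phis [::]; rewrite big_nil mul1r sorted_map; apply.
elim: s {s2 s_alt} sP p => [|[i x] s IHs] sP p.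
  rewrite addn0 cats0 big_nil mulr1 => p2.
  by rewrite sorted_map; exact: phi0.
rewrite /= -cat_rcons big_cons mulrA => ps2 ps_alt.
have [/generated_subalgebraP[q xE] /= phix] := sP (i, x) (mem_head _ _).
have {}xE : x = \sum_(k < size q) q`_k *: a i ^+ k.
  rewrite [LHS]xE -[q in LHS]coefK poly_def linear_sum /=.
  by apply: eq_bigr => k _; rewrite linearZ rmorphXn /= horner_algX mulr_algl.
(* As [phi x = 0], subtracting [phi x] from [x] changes nothing but centers each power of the
   expansion. *)
have {}xE : x =
    \sum_(k < size q) q`_k *: (a i ^+ k - (phi (a i ^+ k))%:A).
  transitivity (x - (phi x)%:A); first by rewrite phix scale0r subr0.
  rewrite xE linear_sum /= scaler_suml -sumrB; apply: eq_bigr => k _.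
  by rewrite phiZ scalerBr scalerA.
rewrite xE mulr_sumr mulr_suml linear_sum big1//= => k _.
rewrite -scalerAr -scalerAl phiZ.
have := IHs _ (rcons p (i, k : nat)); rewrite big_rcons /= => ->.
- by rewrite mulr0.
- by move=> y ys; apply: sP; rewrite inE ys orbT.
- by rewrite size_rcons addSnnS.
- by rewrite map_rcons.
Qed.

(** Both states vanish on alternating products of at least two centered powers and agree on shorter
    ones, and these products span. The uniqueness of free convolutions rests on this. *)
Lemma free_joint_law (I : choiceType) (A B : algType C)
    (phi : ncstate A) (psi : ncstate B) (a : I -> A) (b : I -> B) :
  free_elements phi a -> free_elements psi b ->
  (forall i k, phi (a i ^+ k) = psi (b i ^+ k)) ->
  joint_law phi a =1 joint_law psi b.
Proof.
move=> /free_elementsP phi_free /free_elementsP psi_free ab.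
apply: (@ncpoly_alternating_ind _ _ (fun i k => phi (a i ^+ k))
  [set f | joint_law phi a f = joint_law psi b f]); rewrite /joint_law /=.
  by move=> c f g fE gE; rewrite !linearP /= fE gE.
move=> s s_alt.
have ev (D : algType C) (d : I -> D) :
    nceval d (\prod_(x <- s)
      (ncX C x.1 ^+ x.2 - (phi (a x.1 ^+ x.2))%:A)) =
    \prod_(x <- s) (d x.1 ^+ x.2 - (phi (a x.1 ^+ x.2))%:A).
  rewrite rmorph_prod; apply: eq_bigr => x _ /=.
  by rewrite rmorphB rmorphXn /= ncevalX linearZ rmorph1.
rewrite !ev; case: s s_alt {ev} => [|x [|y s]] s_alt.
- by rewrite !big_nil !ncstate1.
- by rewrite !big_seq1 !ncstateB_cst -ab.
- rewrite phi_free// -[LHS](psi_free _ _ s_alt)//.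
  by under eq_bigr do rewrite -ab.
Qed.

End Freeness.

(** * The involution on noncommutative polynomials *)

Section InAlg.
Variables (K : comNzRingType) (A : algType K).
Implicit Types (a b : K) (u v : A).

Lemma scaler_in_alg a b u : (a * b)%:A * u = a *: (b%:A * u).
Proof. by rewrite -scalerA scalerAl. Qed.

Lemma in_algACA a b u v : (a * b)%:A * (v * u) = (b%:A * v) * (a%:A * u).
Proof. by rewrite -!scalerAl -scalerAr !mul1r scalerA mulrC. Qed.

End InAlg.

(** The antilinear involution reversing products for which all generators are self-adjoint; it makes
    the polynomial algebra a candidate for realizing free convolutions. *)
HB.lock Definition ncstar (K : numClosedFieldType) (I : choiceType)
    (f : ncpoly K I) : ncpoly K I :=
  monalg.mmap (GRing.in_alg (ncpoly K I) \o Num.conj)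
    (fun w : monalg.fmonom I => \prod_(i <- rev w) ncX K i) f.

Section NcStar.
Variables (K : numClosedFieldType) (I : choiceType).
Local Notation ncpoly := (ncpoly K I).
Local Notation ncstar := (@ncstar K I).

Lemma ncstarD : {morph ncstar : f g / f + g}.
Proof. by move=> f g; rewrite ncstar.unlock raddfD. Qed.

Lemma ncstarZ (z : K) f : ncstar (z *: f) = z^* *: ncstar f.
Proof.
rewrite ncstar.unlock (monalg.mmapEw (monalg.msuppZ_le _ _)) monalg.mmapE.
rewrite scaler_sumr; apply: eq_bigr => w _.
by rewrite monalg.mcoeffZ /= rmorphM; exact: scaler_in_alg.
Qed.

Lemma ncstarM f g : ncstar (f * g) = ncstar g * ncstar f.
Proof.
rewrite ncstar.unlock monalg.malgME raddf_sum mulr_sumr /=; apply: eq_bigr => u _.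
rewrite raddf_sum mulr_suml /=; apply: eq_bigr => v _.
rewrite monalg.mmapU /= monalg.fmM rev_cat big_cat /= rmorphM.
exact: in_algACA.
Qed.

Lemma ncstarX i : ncstar (ncX K i) = ncX K i.
Proof.
rewrite ncstar.unlock monalg.mmapU /= rmorph1 scale1r mul1r monalg.fmU.
by rewrite big_seq1.
Qed.

Lemma ncstar1 : ncstar 1 = 1.
Proof.
rewrite ncstar.unlock /GRing.one /= /monalg.fgone monalg.mmapU /= rmorph1.
by rewrite scale1r mul1r monalg.fm1 big_nil.
Qed.

Lemma ncstarK : involutive ncstar.
Proof.
apply: (@ncpoly_ind _ _ [set f | ncstar (ncstar f) = f]) => [c f g fK gK|w] /=.
  by rewrite ncstarD ncstarZ ncstarD ncstarZ fK gK conjCK.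
elim: w => [|i w IHw]; first by rewrite big_nil !ncstar1.
by rewrite big_cons !ncstarM IHw !ncstarX.
Qed.

End NcStar.

Section Star.
Variable R : realType.
Local Notation C := R[i].

Section StarTheory.
Variables (A : algType C) (st : A -> A).
Hypothesis stP : is_star st.

Lemma star_one : st 1 = 1.
Proof.
by case: stP => stK _ _ stM; have := stM (st 1) 1; rewrite mulr1 stK mulr1.
Qed.

Lemma star_prod (T : Type) (s : seq T) (F : T -> A) :
  st (\prod_(x <- s) F x) = \prod_(x <- rev s) st (F x).
Proof.
elim: s => [|x s IHs]; first by rewrite !big_nil star_one.
by case: stP => _ _ _ stM; rewrite big_cons stM IHs rev_cons big_rcons.
Qed.

End StarTheory.

Variable I : choiceType.
Local Notation ncpoly := (ncpoly C I).
Local Notation ncstar := (@ncstar C I).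

Lemma ncstarP : is_star ncstar.
Proof.
split; [exact: ncstarK|exact: ncstarD|exact: ncstarZ|exact: ncstarM].
Qed.

Lemma nceval_star (A : algType C) (st : A -> A) (a : I -> A) f :
  is_star st -> (forall i, st (a i) = a i) ->
  nceval a (ncstar f) = st (nceval a f).
Proof.
move=> stP sta; case: (stP) => _ stD stZ stM; move: f.
apply: (@ncpoly_ind _ _ [set f | nceval a (ncstar f) = st (nceval a f)]).
  move=> c f g /= fE gE; rewrite ncstarD ncstarZ linearD linearZ linearP /= fE gE.
  by rewrite stD stZ.
move=> w /=; rewrite (star_prod ncstarP) !rmorph_prod /= (star_prod stP).
by apply: eq_bigr => i _; rewrite ncstarX ncevalX sta.
Qed.

End Star.

(** * Expectation and independence of bounded random variables *)

Section ExpectationLinf.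
Context d (T : measurableType d) (R : realType) (P : probability T R).
Local Notation Linf := (Lfun P +oo%E).
Implicit Types f g : T -> R.

Lemma LinfB f g : f \in Linf -> g \in Linf -> (fun t => f t - g t) \in Linf.
Proof. by move=> fL gL; apply: (LinfD fL); exact: LinfN. Qed.

Lemma LinfZ (c : R) f : f \in Linf -> (fun t => c * f t) \in Linf.
Proof. by move=> fL; apply: LinfM fL; exact: Linf_cst. Qed.

Lemma Linf_sum (I : Type) (s : seq I) (F : I -> T -> R) :
  (forall i, F i \in Linf) -> (fun t => \sum_(i <- s) F i t) \in Linf.
Proof.
move=> FL; elim: s => [|i s IHs].
  by under eq_fun do rewrite big_nil; exact: Linf_cst.
by under eq_fun do rewrite big_cons; exact: LinfD.
Qed.

Lemma Linf_prod (I : Type) (s : seq I) (F : I -> T -> R) :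
  (forall i, F i \in Linf) -> (fun t => \prod_(i <- s) F i t) \in Linf.
Proof.
move=> FL; elim: s => [|i s IHs].
  by under eq_fun do rewrite big_nil; exact: Linf_cst.
by under eq_fun do rewrite big_cons; exact: LinfM.
Qed.

Lemma LinfX f k : f \in Linf -> (fun t => f t ^+ k) \in Linf.
Proof.
move=> fL; elim: k => [|k IHk].
  by under eq_fun do rewrite expr0; exact: Linf_cst.
by under eq_fun do rewrite exprS; exact: LinfM.
Qed.

Lemma Linf_indic (A : set T) : measurable A -> (\1_A : T -> R) \in Linf.
Proof.
move=> mA; apply/LinfP; split; first exact: measurable_indic.
by exists 1; apply: nearW => t; rewrite indicE; case: (t \in A);
  rewrite ?normr1 ?normr0.
Qed.

Lemma Linf_measurable f : f \in Linf -> measurable_fun setT f.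
Proof. by case/LinfP. Qed.

Lemma Rexpectation_cst (c : R) : \int[P]_t c = c.
Proof.
rewrite Rintegral_cst// (_ : fine _ = 1) ?mulr1//.
by have := probability_setT P; move=> /= ->.
Qed.

Lemma RexpectationD f g : f \in Linf -> g \in Linf ->
  \int[P]_t (f t + g t) = \int[P]_t f t + \int[P]_t g t.
Proof. by move=> fL gL; rewrite RintegralD//; exact: Linf_integrable. Qed.

Lemma RexpectationB f g : f \in Linf -> g \in Linf ->
  \int[P]_t (f t - g t) = \int[P]_t f t - \int[P]_t g t.
Proof. by move=> fL gL; rewrite RintegralB//; exact: Linf_integrable. Qed.

Lemma RexpectationZ (c : R) f : f \in Linf ->
  \int[P]_t (c * f t) = c * \int[P]_t f t.
Proof. by move=> fL; rewrite RintegralZl//; exact: Linf_integrable. Qed.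

Lemma Rexpectation_sum (I : Type) (s : seq I) (F : I -> T -> R) :
  (forall i, F i \in Linf) ->
  \int[P]_t (\sum_(i <- s) F i t) = \sum_(i <- s) \int[P]_t F i t.
Proof.
move=> FL; elim: s => [|i s IHs].
  by rewrite big_nil; under eq_Rintegral do rewrite big_nil;
    exact: Rexpectation_cst.
rewrite big_cons -IHs -RexpectationD//; last exact: Linf_sum.
by under eq_Rintegral do rewrite big_cons.
Qed.

Lemma Rexpectation_indic (A : set T) : measurable A ->
  \int[P]_t (\1_A t : R) = fine (P A).
Proof. by move=> mA; rewrite /Rintegral integral_indic ?setIT. Qed.

Lemma ae_eq_Rexpectation f g : f \in Linf -> g \in Linf ->
  (\forall t \ae P, f t = g t) -> \int[P]_t f t = \int[P]_t g t.
Proof.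
move=> /Linf_measurable mf /Linf_measurable mg fg.
congr fine; apply: ae_eq_integral => //; [exact/measurable_EFinP..|].
by apply: filterS fg => t /= -> _.
Qed.

Lemma ae_le_Rexpectation f g : f \in Linf -> g \in Linf ->
  (\forall t \ae P, f t <= g t) -> \int[P]_t f t <= \int[P]_t g t.
Proof.
move=> fL gL fg; rewrite -subr_ge0 -RexpectationB//.
have hL := LinfB gL fL.
rewrite (_ : \int[P]_t (g t - f t) = \int[P]_t `|g t - f t|).
  by apply: Rintegral_ge0 => t _.
apply: ae_eq_Rexpectation => //; last first.
  by apply: filterS fg => t fgt; rewrite ger0_norm// subr_ge0.
case/LinfP : hL => mh [M hM]; apply/LinfP; split.
  exact: measurableT_comp.
by exists M; apply: filterS hM => t; rewrite normr_id.
Qed.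

Lemma normr_Rexpectation_le f (M : R) : f \in Linf ->
  (\forall t \ae P, `|f t| <= M) -> `|\int[P]_t f t| <= M.
Proof.
move=> fL fM; rewrite ler_norml -[- M]Rexpectation_cst -[M in _ && (_ <= M)]Rexpectation_cst.
by apply/andP; split; apply: ae_le_Rexpectation; rewrite ?fL ?Linf_cst//;
  apply: filterS fM => t; rewrite ler_norml => /andP[].
Qed.

End ExpectationLinf.

(** * Expectations of products of independent bounded variables *)

Section Independence.
Context d (T : measurableType d) (R : realType) (P : probability T R).
Local Notation Linf := (Lfun P +oo%E).

(** The sum counts the integers from 1 to [K] that are at most [y], so it equals the minimum of [K]
    and the integer part of [y]. *)
Lemma layer_sum_bounds (y : R) (K : nat) : 0 <= y ->
  Num.min K%:R (y - 1) <= \sum_(j < K) ((j.+1%:R <= y)%R%:R : R) <= Num.min K%:R y.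
Proof.
move=> y0; elim: K => [|K IHK].
  by rewrite big_ord0 ge_min lexx/= le_min lexx y0.
rewrite big_ord_recr/=; case/andP: IHK; rewrite le_min => lo /andP[hiK hiy].
have [Ky|yK] := leP K.+1%:R y.
  apply/andP; split.
    move: lo; rewrite min_l; last by rewrite lerBrDr natr1.
    by move=> lo; rewrite ge_min -natr1 lerD2r lo.
  by rewrite -natr1 lerD2r.
rewrite addr0 hiy andbT; move: lo; rewrite min_r; last first.
  by rewrite lerBlDr natr1 ltW.
by move=> lo; rewrite ge_min lo orbT.
Qed.

Lemma le_divn_eq0 (x c : R) : (forall n, `|x| <= c / n.+1%:R) -> x = 0.
Proof.
move=> xc; apply/eqP/negPn/negP => x0.
have := xc (Num.truncn (c / `|x|)); rewrite ler_pdivlMr// mulrC.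
by rewrite -ler_pdivlMr ?normr_gt0// leNgt truncnS_gt.
Qed.

(* [Z] is uniformly approximated by [floor(n (Z + M)) / n - M], which is a sum
   of indicator functions of events determined by [Z]. *)
Lemma indep_expectationM (Z G : T -> R) : Z \in Linf -> G \in Linf ->
  (forall B : set R, measurable B ->
    \int[P]_t (\1_(Z @^-1` B) t * G t) = fine (P (Z @^-1` B)) * \int[P]_t G t) ->
  \int[P]_t (Z t * G t) = \int[P]_t Z t * \int[P]_t G t.
Proof.
move=> ZL GL indep; have [/Linf_measurable mZ /LinfP[mG [N GN]]] := (ZL, GL).
have mZB B : measurable B -> measurable (Z @^-1` B).
  by move=> mB; rewrite -[_ @^-1` _]setTI; exact: mZ.
have [_ [M ZM]] := (LinfP _ _).1 ZL.
have N0 : 0 <= N.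
  apply: (le_trans _ (normr_Rexpectation_le GL GN)); exact: normr_ge0.
pose S n K t : R := n.+1%:R^-1 *
  \sum_(j < K) \1_(Z @^-1` [set z | j.+1%:R <= n.+1%:R * (z + M)]) t.
have mS n j : measurable [set z : R | j.+1%:R <= n.+1%:R * (z + M)].
  rewrite (_ : mkset _ = `[j.+1%:R / n.+1%:R - M, +oo[%classic).
    exact: measurable_itv.
  apply/seteqP; split=> z /=; rewrite in_itv/= andbT lerBlDr;
    by rewrite ler_pdivrMr// mulrC.
have SL n K : S n K \in Linf.
  by apply: LinfZ; apply: Linf_sum => j; apply: Linf_indic; exact: mZB.
have SG n K : \int[P]_t (S n K t * G t) = \int[P]_t S n K t * \int[P]_t G t.
  rewrite RexpectationZ; last first.
    by apply: Linf_sum => j; apply: Linf_indic; exact: mZB.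
  under eq_Rintegral do rewrite -mulrA.
  rewrite RexpectationZ; last first.
    by apply: LinfM => //; apply: Linf_sum => j; apply: Linf_indic; exact: mZB.
  rewrite -mulrA; congr (_ * _).
  under eq_Rintegral do rewrite mulr_suml.
  rewrite !Rexpectation_sum => [||j].
  - rewrite mulr_suml; apply: eq_bigr => j _.
    by rewrite indep// Rexpectation_indic//; exact: mZB.
  - by move=> j; apply: Linf_indic; exact: mZB.
  - by apply: LinfM => //; apply: Linf_indic; exact: mZB.
have Sapprox n : exists K, \forall t \ae P, `|Z t + M - S n K t| <= n.+1%:R^-1.
  (* Almost surely Z + M lies between 0 and 2 M, so this many layers exceed [y] and truncation at
     [K] has no effect. *)
  exists (Num.truncn (n.+1%:R * (M + M))).+1; apply: filterS ZM => t ZtM.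
  set y := n.+1%:R * (Z t + M).
  have y0 : 0 <= y.
    by rewrite mulr_ge0// -lerBlDr sub0r; move: ZtM; rewrite ler_norml => /andP[].
  have yK : y < (Num.truncn (n.+1%:R * (M + M))).+1%:R.
    rewrite (le_lt_trans _ (truncnS_gt _))// ler_wpM2l// lerD2r.
    exact: le_trans (ler_norm _) ZtM.
  have := layer_sum_bounds (Num.truncn (n.+1%:R * (M + M))).+1 y0.
  rewrite !min_r ?(ltW yK)//; last first.
    by rewrite (le_trans _ (ltW yK))// lerBlDr lerDl.
  set s := \sum_(j < _) _ => /andP[s1 s2].
  have -> : S n (Num.truncn (n.+1%:R * (M + M))).+1 t = n.+1%:R^-1 * s.
    congr (_ * _); apply: eq_bigr => j _; rewrite indicE; congr (_%:R).
    by congr nat_of_bool; apply/idP/idP; rewrite inE.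
  have -> : Z t + M = n.+1%:R^-1 * y by rewrite mulKf// pnatr_eq0.
  rewrite -mulrBr normrM ger0_norm ?invr_ge0// ler_piMr ?invr_ge0//.
  by rewrite ler_norml; apply/andP; split; lra.
have WL : (fun t => Z t + M) \in Linf by apply: LinfD => //; exact: Linf_cst.
apply/eqP; rewrite -subr_eq0; apply/eqP.
apply: (@le_divn_eq0 _ (N + N)) => n; have [K SK] := Sapprox n.
have DL : (fun t => Z t + M - S n K t) \in Linf by exact: LinfB.
(* The constant [M] and the step function [S n K] both satisfy the product formula, so only the
   approximation error is left. *)
have -> : \int[P]_t (Z t * G t) - \int[P]_t Z t * \int[P]_t G t =
    \int[P]_t ((Z t + M - S n K t) * G t) -
    \int[P]_t (Z t + M - S n K t) * \int[P]_t G t.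
  have L1 : (fun t => Z t * G t) \in Linf := LinfM ZL GL.
  have L2 : (fun t => M * G t) \in Linf := LinfZ M GL.
  have L3 : (fun t => S n K t * G t) \in Linf := LinfM (SL n K) GL.
  have L4 := LinfD L1 L2.
  have cL : (fun=> M) \in Linf := Linf_cst P M.
  transitivity (\int[P]_t (Z t * G t + M * G t - S n K t * G t) -
      \int[P]_t (Z t + M - S n K t) * \int[P]_t G t); last first.
    by congr (_ - _); apply: eq_Rintegral => t _; ring.
  rewrite (RexpectationB L4 L3) (RexpectationD L1 L2) (RexpectationZ M GL) SG.
  by rewrite RexpectationB// RexpectationD// Rexpectation_cst; ring.
have N1 : `|\int[P]_t ((Z t + M - S n K t) * G t)| <= N / n.+1%:R.
  apply: normr_Rexpectation_le; first exact: LinfM.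
  apply: filterS2 SK GN => t SKt GNt.
  by rewrite normrM mulrC ler_pM.
have N2 : `|\int[P]_t (Z t + M - S n K t) * \int[P]_t G t| <= N / n.+1%:R.
  rewrite normrM mulrC ler_pM//; exact: normr_Rexpectation_le.
by rewrite (le_trans (ler_normB _ _))// mulrDl lerD.
Qed.

Lemma prod_indic (I : choiceType) (s : seq I) (A : I -> set T) t :
  \prod_(i <- s) \1_(A i) t = \1_(\bigcap_(i in [set` s]) A i)%classic t :> R.
Proof.
rewrite bigcap_seq; elim: s => [|i s IHs]; first by rewrite !big_nil indicT.
by rewrite !big_cons IHs indicI.
Qed.

(** Independence gives the formula for indicators. In [F K B] the factors with index in [K] are the
    variables themselves and the others are indicators of arbitrary events; as [K] grows, indicators
    are exchanged for variables one at a time by [indep_expectationM]. *)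
Lemma indep_expectation_prod d' (S : measurableType d') (xi : nat -> T -> S)
    (f : nat -> S -> R) (J : seq nat) : uniq J ->
  (forall B : nat -> set S, (forall i, measurable (B i)) ->
    P (\bigcap_(i in [set` J]) (xi i @^-1` B i)) =
    (\prod_(i <- J) P (xi i @^-1` B i))%E) ->
  (forall i, measurable_fun setT (f i)) ->
  (forall i, (fun t => f i (xi i t)) \in Linf) ->
  \int[P]_t (\prod_(i <- J) f i (xi i t)) =
  \prod_(i <- J) \int[P]_t f i (xi i t).
Proof.
move=> uJ indep mf fL; pose Z i t := f i (xi i t).
have mZB i B : measurable B -> measurable (Z i @^-1` B).
  by move=> mB; rewrite -[_ @^-1` _]setTI; exact: (Linf_measurable (fL i)).
pose F (K : seq nat) (B : nat -> set R) i t : R :=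
  if i \in K then Z i t else \1_(Z i @^-1` B i) t.
have FL K B i : (forall i, measurable (B i)) -> F K B i \in Linf.
  move=> mB; rewrite /F; case: (i \in K); first exact: fL.
  by apply: Linf_indic; exact: mZB.
suff EF K B : (forall i, measurable (B i)) ->
    \int[P]_t (\prod_(i <- J) F K B i t) = \prod_(i <- J) \int[P]_t F K B i t.
  have := EF J (fun=> setT) (fun=> measurableT).
  rewrite (_ : (fun t => _) = (fun t => \prod_(i <- J) Z i t)).
    by move=> ->; apply: eq_big_seq => i iJ; rewrite /F iJ.
  by apply/funext => t; apply: eq_big_seq => i iJ; rewrite /F iJ.
elim: K B => [|x K IHK] B mB.
  rewrite (_ : (fun t => _) =
      \1_(\bigcap_(i in [set` J]) (Z i @^-1` B i))); last first.
    by apply/funext => t; rewrite -prod_indic.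
  rewrite Rexpectation_indic; last first.
    by rewrite bigcap_seq; apply: bigsetI_measurable => i _; exact: mZB.
  rewrite (indep (fun i => f i @^-1` B i)); last first.
    by move=> i; rewrite -[_ @^-1` _]setTI; exact: mf.
  rewrite (_ : (\prod_(i <- J) _)%E =
      (\prod_(i <- J) fine (P (Z i @^-1` B i)))%:E).
    by apply: eq_bigr => i _; rewrite /F/= Rexpectation_indic//; exact: mZB.
  elim/big_ind2 : _ => // [_ r _ s -> ->|i _]; first by rewrite EFinM.
  by rewrite fineK// fin_num_measure//; exact: mZB.
have [xK|xK] := boolP (x \in K).
  have FE i t : F (x :: K) B i t = F K B i t.
    by rewrite /F inE; have [->|] := eqVneq i x; rewrite ?xK.
  have -> : F (x :: K) B = F K B by apply/funext => i; exact/funext.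
  exact: IHK.
have [xJ|xJ] := boolP (x \in J); last first.
  have FE i : i \in J -> F (x :: K) B i = F K B i.
    move=> iJ; apply/funext => t; rewrite /F inE.
    by case: eqVneq iJ xJ => // -> ->.
  rewrite (eq_big_seq (fun i => \int[P]_t F K B i t)) => [|i /FE ->//].
  rewrite -IHK//; apply: eq_Rintegral => t _.
  by apply: eq_big_seq => i /FE ->.
have D1 (h : nat -> R) :
    \prod_(i <- J) h i = h x * \prod_(i <- J | i != x) h i.
  by rewrite (bigD1_seq x).
pose G t := \prod_(i <- J | i != x) F K B i t.
have GL : G \in Linf.
  rewrite /G; under eq_fun do rewrite -big_filter.
  by apply: Linf_prod => i; exact: FL.
have FG i t : i != x -> F (x :: K) B i t = F K B i t.
  by move=> ix; rewrite /F inE (negPf ix).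
have indepG A : measurable A -> \int[P]_t (\1_(Z x @^-1` A) t * G t) =
    fine (P (Z x @^-1` A)) * \prod_(i <- J | i != x) \int[P]_t F K B i t.
  (* The induction hypothesis covers all events, so the event at [x] may be prescribed; this yields
     the independence of [Z x] from the remaining product [G]. *)
  move=> mA; pose B' i := if i == x then A else B i.
  have FB' i t : i != x -> F K B' i t = F K B i t.
    by move=> ix; rewrite /F /B' (negPf ix).
  have mB' i : measurable (B' i) by rewrite /B'; case: ifP.
  have FB'x : F K B' x = \1_(Z x @^-1` A).
    by apply/funext => t; rewrite /F (negPf xK) /B' eqxx.
  have EFx : \int[P]_t F K B' x t = fine (P (Z x @^-1` A)).
    by rewrite FB'x Rexpectation_indic//; exact: mZB.
  have := IHK _ mB'; rewrite [in RHS]D1 EFx.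
  under [in RHS]eq_bigr => i ix.
    rewrite (_ : F K B' i = F K B i); last by apply/funext => t; exact: FB'.
    over.
  move=> <-; apply: eq_Rintegral => t _.
  rewrite D1 FB'x; congr (_ * _); apply: eq_bigr => i ix.
  by rewrite FB'.
have EG : \int[P]_t G t = \prod_(i <- J | i != x) \int[P]_t F K B i t.
  have := indepG _ measurableT; rewrite preimage_setT.
  rewrite (_ : fine _ = 1) ?mul1r => [<-|]; last first.
    by have := probability_setT P; move=> /= ->.
  by apply: eq_Rintegral => t _; rewrite indicT mul1r.
have -> : \prod_(i <- J) \int[P]_t F (x :: K) B i t =
    \int[P]_t Z x t * \prod_(i <- J | i != x) \int[P]_t F (x :: K) B i t.
  rewrite D1; congr (_ * _).
  by apply: eq_Rintegral => t _; rewrite /F mem_head.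
under eq_bigr => i ix.
  rewrite (_ : F (x :: K) B i = F K B i); last first.
    by apply/funext => t; exact: FG.
  over.
rewrite -EG -indep_expectationM//; last first.
- by move=> A mA; rewrite EG; exact: indepG.
- exact: fL.
apply: eq_Rintegral => t _; rewrite D1 {1}/F mem_head.
by congr (_ * _); apply: eq_bigr => i ix; exact: FG.
Qed.

End Independence.

(** * The trace of products of diagonal and Hadamard matrices *)

Section TracePaths.
Variables (C : numDomainType) (n : nat).
Local Notation N := n.+1.

Lemma sum_tuple_cons (V : nmodType) (S : finType) m (a : S)
    (F : m.+1.-tuple S -> V) :
  \sum_(I | thead I == a) F I = \sum_(I : m.-tuple S) F [tuple of a :: I].
Proof.
rewrite (reindex_onto (fun I : m.-tuple S => [tuple of a :: I])
  (fun I => [tuple of behead I])) => [|I /eqP aI].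
  apply: eq_bigl => I; rewrite theadE eqxx /=; apply/eqP/val_inj => /=.
  by [].
by rewrite [RHS]tuple_eta; apply/val_inj; rewrite /= -aI.
Qed.

(* The weight [w] collects the entries of the [h k] along the path [I]; it does
   not depend on the diagonal entries [z]. *)
Lemma mulmx_paths m (h : nat -> 'M[C]_N) :
  (forall k i j, `|h k i j| = 1) ->
  exists2 w : 'I_N -> m.-tuple 'I_N -> C, (forall b I, `|w b I| = 1) &
  forall (z : nat -> 'I_N -> C) a b,
    (\prod_(k < m) (diag_mx (\row_i z k i) *m h k)) a b =
    \sum_(I : m.-tuple 'I_N | head b I == a)
      (\prod_(k < m) z k (tnth I k)) * w b I.
Proof.
elim: m h => [|m IHm] h h1.
  (* The default [b] of [head] is the endpoint of the path: on the empty path the condition reads b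
     = a, which gives the entry of the identity matrix. *)
  exists (fun _ _ => 1) => [b I|z a b]; first by rewrite normr1.
  rewrite big_ord0 mxE; transitivity (\sum_(I : 0.-tuple 'I_N) (a == b)%:R : C).
    rewrite (big_pred1 [tuple])// => I; apply/esym/eqP; exact: tuple0.
  rewrite [RHS]big_mkcond; apply: eq_bigr => I _.
  by rewrite tuple0 /= eq_sym big_ord0 mulr1; case: eqP.
have [w w1 wE] := IHm (fun k => h k.+1) (fun k => h1 k.+1).
exists (fun b I => h 0%N (thead I) (head b (behead I)) * w b [tuple of behead I]).
  by move=> b I; rewrite normrM h1 w1 mulr1.
move=> z a b; rewrite big_ord_recl.
rewrite [RHS](eq_bigl (fun I => thead I == a)) => [|I]; last first.
  by rewrite (tuple_eta I).
rewrite sum_tuple_cons mxE.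
transitivity (\sum_c \sum_(I : m.-tuple 'I_N | head b I == c)
    z 0%N a * h 0%N a c * ((\prod_(k < m) z k.+1 (tnth I k)) * w b I)).
  apply: eq_bigr => c _; rewrite (wE (fun k => z k.+1)) mulr_sumr.
  by apply: eq_bigr => I _; rewrite mul_diag_mx !mxE.
rewrite [LHS](exchange_big_dep xpredT)//=; apply: eq_bigr => I _.
rewrite (big_pred1 (head b I)) => [|c]; last by rewrite eq_sym.
rewrite big_ord_recl tnth0 theadE -!mulrA; congr (_ * _).
rewrite mulrCA; congr (_ * (_ * _)).
  by apply: eq_bigr => k _; rewrite tnthS.
by congr (w b _); apply/val_inj.
Qed.

Lemma mxtrace_paths m (h : nat -> 'M[C]_N) :
  (forall k i j, `|h k i j| = 1) ->
  exists2 w : m.+1.-tuple 'I_N -> C, (forall I, `|w I| = 1) &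
  forall z : nat -> 'I_N -> C,
    \tr (\prod_(k < m.+1) (diag_mx (\row_i z k i) *m h k)) =
    \sum_(I : m.+1.-tuple 'I_N) (\prod_(k < m.+1) z k (tnth I k)) * w I.
Proof.
move=> /(mulmx_paths m.+1)[w w1 wE]; exists (fun I => w (thead I) I) => // z.
rewrite /mxtrace (eq_bigr _ (fun a _ => wE z a a)).
rewrite (exchange_big_dep xpredT)//=; apply: eq_bigr => I _.
by rewrite (big_pred1 (thead I))// => c; rewrite (tuple_eta I) /= eq_sym theadE.
Qed.

End TracePaths.

(** * Counting index maps with few values *)

Section PairedTuples.
Variables (m l n : nat).

(** A map with at most l + 1 values factors through a set of l + 1 elements; the bound counts the
    pairs of factors. *)
Lemma card_small_image :
  (#|[set I : m.-tuple 'I_n.+1 |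
       (#|[set tnth I k | k : 'I_m]%SET| <= l.+1)%N]%SET|
     <= l.+1 ^ m * n.+1 ^ l.+1)%N.
Proof.
pose G (gh : {ffun 'I_m -> 'I_l.+1} * {ffun 'I_l.+1 -> 'I_n.+1}) :=
  [tuple gh.2 (gh.1 k) | k < m].
have -> : (l.+1 ^ m * n.+1 ^ l.+1 = #|[set: {ffun 'I_m -> 'I_l.+1} *
    {ffun 'I_l.+1 -> 'I_n.+1}]%SET|)%N.
  by rewrite cardsT card_prod !card_ffun !card_ord.
apply: leq_trans (leq_imset_card G _); apply/subset_leq_card/fintype.subsetP => I.
rewrite inE => Il; apply/imsetP.
pose S := [set tnth I k | k : 'I_m]%SET.
exists ([ffun k => inord (index (tnth I k) (enum S))],
        [ffun j : 'I_l.+1 => nth ord0 (enum S) j]) => //.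
apply: eq_from_tnth => k; rewrite tnth_mktuple /= !ffunE.
have kS : tnth I k \in enum S by rewrite mem_enum; apply: imset_f.
rewrite inordK ?nth_index// (leq_trans _ Il)// cardE.
by rewrite -/S index_mem.
Qed.

(* Every value of [I] has at least two antecedents, except possibly the value at
   [k0]; as [m] is even, this exception is immaterial. *)
Lemma paired_image (k0 : 'I_m) (I : m.-tuple 'I_n.+1) : m = l.*2 ->
  (forall k, k != k0 -> exists2 k', k' != k & tnth I k' = tnth I k) ->
  (#|[set tnth I k | k : 'I_m]%SET| <= l)%N.
Proof.
move=> ml Ipair; set S := [set _ | _ in _]%SET.
(* The fibres of [I] have total size [m], and each has at least two elements, or one over the value
   at [k0]. Hence 2 |S| - 1 <= 2 l, so that |S| <= l. *)
have : (\sum_(p in S) (2 - (p == tnth I k0)) <= m)%N.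
  rewrite -[leqRHS]card_ord -sum1_card.
  rewrite (partition_big (tnth I) (mem S)) => [|k _]; last exact: imset_f.
  apply: leq_sum => p /imsetP[k _ ->]; rewrite sum1_card.
  have [kk0|kk0] := eqVneq (tnth I k) (tnth I k0).
    by apply/card_gt0P; exists k; exact: eqxx.
  have [k' k'k k'I] : exists2 k', k' != k & tnth I k' = tnth I k.
    by apply: Ipair; apply: contra_neq kk0 => ->.
  rewrite subn0; apply: leq_trans (subset_leq_card (_ : [set k'; k]%SET \subset _)).
    by rewrite cards2 k'k.
  apply/fintype.subsetP => x; rewrite in_set2 => /orP[] /eqP ->.
  by apply/eqP; rewrite ?k'I.
  exact: eqxx.
have S0 : tnth I k0 \in S by exact: imset_f.
rewrite (bigD1 _ S0)/= eqxx subSS subn0 (eq_bigr (fun=> 2%N)) => [|p /andP[_]].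
  rewrite sum_nat_cond_const (_ : #|_| = #|S :\ tnth I k0|%SET).
    move: (cardsD1 (tnth I k0) S); rewrite S0 => SE le2.
    by move: #|_ :\ _|%SET #|S| SE le2 => a b; lia.
  by apply: eq_card => p; rewrite !inE andbC.
by move=> /negPf ->.
Qed.

End PairedTuples.

Section ComplexExpectation.
Context d (T : measurableType d) (R : realType) (P : probability T R).
Local Notation C := R[i].
Local Notation Linf := (Lfun P +oo%E).

Lemma normc_real (x : R) : `|x%:C| = `|x|%:C.
Proof.
have pos (y : R) : 0 <= y -> `|y%:C| = `|y|%:C.
  by move=> y0; rewrite !ger0_norm ?ler0c.
have [/pos//|x0] := leP 0 x.
by rewrite -(opprK x) rmorphN !(normrN (- x)) normrN pos// oppr_ge0 ltW.
Qed.

Lemma cexpectation_real (f : T -> R) :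
  cexpectation P (fun t => (f t)%:C) = (\int[P]_t f t)%:C.
Proof. by rewrite /cexpectation /= Rexpectation_cst. Qed.

Lemma cLinfZr (z : C) (f : T -> R) : f \in Linf ->
  cLinf P (fun t => (f t)%:C * z).
Proof. by move=> fL; apply: cLinfM; [exact: cLinf_real|exact: cLinf_cst]. Qed.

Lemma cexpectation_sum (I : Type) (s : seq I) (F : I -> T -> R) (w : I -> C) :
  (forall i, F i \in Linf) ->
  cexpectation P (fun t => \sum_(i <- s) (F i t)%:C * w i) =
  \sum_(i <- s) (\int[P]_t F i t)%:C * w i.
Proof.
move=> FL; elim: s => [|i s IHs].
  under [X in cexpectation P X]eq_fun do rewrite big_nil.
  by rewrite big_nil (cexpectation_real (fun=> 0)) Rexpectation_cst.
under [X in cexpectation P X]eq_fun do rewrite big_cons.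
rewrite big_cons cexpectationD; [|exact: cLinfZr|]; last first.
  by apply: cLinf_sum => j; exact: cLinfZr.
rewrite IHs; congr (_ + _).
under [X in cexpectation P X]eq_fun do rewrite mulrC.
by rewrite cexpectationZ ?cexpectation_real 1?mulrC//; exact: cLinf_real.
Qed.

End ComplexExpectation.

Section TraceEstimate.
Context d (T : measurableType d) (R : realType) (P : probability T R).
Context d' (S : measurableType d').
Local Notation C := R[i].
Local Notation Linf := (Lfun P +oo%E).

Definition independent_seq (xi : nat -> T -> S) :=
  forall (s : seq nat) (B : nat -> set S), uniq s ->
    (forall i, measurable (B i)) ->
    P (\bigcap_(i in [set` s]) (xi i @^-1` B i)) =
    (\prod_(i <- s) P (xi i @^-1` B i))%E.

(* [f k] stands for the k-th diagonal matrix, with entries [f k (xi p)]. *)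
Variables (xi : nat -> T -> S) (f : nat -> S -> R) (M : R).
Hypothesis xi_indep : independent_seq xi.
Hypothesis xi_measurable : forall p, measurable_fun setT (xi p).
Hypothesis f_measurable : forall k, measurable_fun setT (f k).
Hypothesis f_bounded : forall k p, \forall t \ae P, `|f k (xi p t)| <= M.

Lemma f_Linf k p : (fun t => f k (xi p t)) \in Linf.
Proof.
by apply/LinfP; split; [exact: measurableT_comp|exists M].
Qed.

(** Factors are grouped by the value of the index, so that independence splits the expectation over
    the values. The group at the value of [k1] is a single centered factor. *)
Lemma expectation_path0 n m (I : m.-tuple 'I_n) (k1 : 'I_m) :
  (forall p, \int[P]_t f k1 (xi p t) = 0) ->
  (forall k, tnth I k = tnth I k1 -> k = k1) ->
  \int[P]_t \prod_(k < m) f k (xi (tnth I k) t) = 0.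
Proof.
move=> fk1 Ik1; pose g p s := \prod_(k < m | tnth I k == p :> nat) f k s.
transitivity (\int[P]_t \prod_(p <- iota 0 n) g p (xi p t)).
  apply: eq_Rintegral => t _.
  rewrite (partition_big (tnth I) xpredT)//=.
  rewrite -[X in iota 0 X]subn0 -/(index_iota 0 n) big_mkord.
  by apply: eq_bigr => p _; apply: eq_bigr => k /eqP ->.
have gL p : (fun t => g p (xi p t)) \in Linf.
  rewrite /g; under eq_fun do rewrite -big_filter.
  by apply: Linf_prod => k; exact: f_Linf.
rewrite (indep_expectation_prod (f := g)) ?iota_uniq//; last first.
- move=> p; rewrite /g; under eq_fun do rewrite -big_filter.
  elim: [seq _ <- _ | _] => [|k s IHs].
    by under eq_fun do rewrite big_nil; exact: measurable_cst.
  by under eq_fun do rewrite big_cons; exact: measurable_funM.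
- by move=> B mB; exact: xi_indep (iota_uniq _ _) mB.
rewrite (bigD1_seq (tnth I k1 : nat)) ?iota_uniq ?mem_iota//=.
rewrite [X in X * _](_ : _ = 0) ?mul0r//.
rewrite -[RHS](fk1 (tnth I k1)); apply: eq_Rintegral => t _.
rewrite /g (big_pred1 k1)// => k; apply/eqP/eqP => [/val_inj/Ik1//|->//].
Qed.

(** The bound is the number of index maps with at most l + 1 values, estimated by
    [card_small_image], times the bound on one product; all other index maps contribute 0. *)
Lemma trace_estimate n l (k0 : 'I_(l.+1).*2) (h : nat -> 'M[C]_n.+1) :
  (forall k i j, `|h k i j| = 1) ->
  (forall k p, k != k0 :> nat -> (k < l.+1.*2)%N ->
     \int[P]_t f k (xi p t) = 0) ->
  `|cexpectation P (fun t => \tr (\prod_(k < l.+1.*2)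
      (diag_mx (\row_(i < n.+1) (f k (xi i t))%:C) *m h k)))| <=
  ((l.+1 ^ l.+1.*2 * n.+1 ^ l.+1)%:R * M ^+ l.+1.*2)%:C.
Proof.
move=> h1 f0; have M0 : 0 <= M.
  apply: (le_trans _ (normr_Rexpectation_le (f_Linf 0 0) (f_bounded 0 0))).
  exact: normr_ge0.
have [w w1 wE] := mxtrace_paths l.*2.+1 h1.
pose F (I : l.+1.*2.-tuple 'I_n.+1) t := \prod_(k < l.+1.*2) f k (xi (tnth I k) t).
have FL I : F I \in Linf by apply: Linf_prod => k; exact: f_Linf.
under [X in cexpectation P X]eq_fun => t.
  rewrite (wE (fun k i => (f k (xi i t))%:C)).
  under eq_bigr do rewrite -rmorph_prod/=.
  over.
rewrite (cexpectation_sum _ _ FL).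
have FM I : `|\int[P]_t F I t| <= M ^+ l.+1.*2.
  apply: normr_Rexpectation_le => //.
  have : \forall t \ae P, forall k : 'I_(l.+1.*2),
      `|f k (xi (tnth I k) t)| <= M.
    by apply: filter_forall => k; exact: f_bounded.
  apply: filterS => t fM; rewrite /F normr_prod.
  rewrite -[in leRHS](card_ord l.+1.*2) -prodr_const.
  by apply: ler_prod => k _; rewrite normr_ge0 fM.
(* By contraposition: a nonzero expectation forces every position other than [k0] to share its index
   with another one. *)
have F0 I : (l.+1 < #|[set tnth I k | k : 'I_(l.+1.*2)]%SET|)%N ->
    \int[P]_t F I t = 0.
  move=> lI; apply/eqP/negPn/negP => FI; move: lI; rewrite ltnNge => /negP; apply.
  apply: (paired_image (k0 := k0)) => // k kk0.
  apply/exists2P/not_existsP => Ik; case/eqP: FI.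
  apply: (expectation_path0 (k1 := k)) => [p|k' k'I]; first exact: f0.
  apply/eqP/negPn/negP => k'k; exact: (Ik k').
apply: le_trans (ler_norm_sum _ _ _) _.
pose G := [set I : l.+1.*2.-tuple 'I_n.+1 |
   (#|[set tnth I k | k : 'I_(l.+1.*2)]%SET| <= l.+1)%N]%SET.
have bound I : `|(\int[P]_t F I t)%:C * w I| <=
    if I \in G then (M ^+ l.+1.*2)%:C else 0.
  rewrite normrM w1 mulr1 normc_real inE; case: leqP => [_|/F0 ->].
    by rewrite lecR FM.
  by rewrite normr0.
apply: le_trans (ler_sum _ (fun I _ => bound I)) _.
rewrite -big_mkcond sumr_const -rmorphMn lecR -mulr_natl.
by rewrite ler_wpM2r ?exprn_ge0// ler_nat; exact: card_small_image.
Qed.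

End TraceEstimate.

(** * Reduction of alternating matrix words to closed paths *)

Section AlternatingMatrices.
Variables (C : numFieldType) (n : nat) (H Hs : 'M[C]_n.+1).
Local Notation N := n.+1.
Implicit Types (b : bool) (u v : 'rV[C]_N).

Definition diag_or_conj b v : 'M[C]_N :=
  if b then diag_mx v else N%:R^-1 *: (H *m diag_mx v *m Hs).

Fixpoint alternating_prod b (vs : seq 'rV[C]_N) : 'M[C]_N :=
  if vs is v :: vs' then diag_or_conj b v *m alternating_prod (~~ b) vs'
  else 1%:M.

Lemma alternating_prod_rcons b vs v : alternating_prod b (rcons vs v) =
  alternating_prod b vs *m diag_or_conj (b (+) odd (size vs)) v.
Proof.
elim: vs b => [|u vs IHvs] b /=; first by rewrite mulmx1 mul1mx addbF.
by rewrite IHvs mulmxA addNb addbN.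
Qed.

(** Regrouping lets each diagonal factor be followed by a single [H] or [Hs], the form required by
    [mxtrace_paths]; each conjugate supplies one factor 1/N. *)
Lemma alternating_prod_double l (vs : seq 'rV[C]_N) : size vs = l.*2 ->
  alternating_prod true vs = N%:R ^- l *:
    \prod_(k < l.*2) (diag_mx (nth 0 vs k) *m (if odd k then Hs else H)).
Proof.
elim: l vs => [|l IHl] [|u [|v vs]]//=; first by rewrite big_ord0 invr1 scale1r.
case=> /IHl ->; rewrite doubleS !big_ord_recl /=.
under [in RHS]eq_bigr do rewrite /= negbK.
rewrite exprSr invfM -!scalemxAr -scalemxAl -scalemxAr scalerA mulrC.
by rewrite -!mulmxE !mulmxA.
Qed.

Hypothesis HsH : Hs *m H = N%:R%:M.

Lemma diag_or_conjM b u v :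
  diag_or_conj b u *m diag_or_conj b v =
  diag_or_conj b (\row_i (u 0 i * v 0 i)).
Proof.
case: b; rewrite /= ?mulmx_diag//.
have HsHE : (H *m diag_mx u *m Hs) *m (H *m diag_mx v *m Hs) =
    N%:R *: (H *m (diag_mx u *m diag_mx v) *m Hs).
  rewrite !mulmxA -(mulmxA (H *m diag_mx u)) HsH mul_mx_scalar.
  by rewrite -!scalemxAl.
rewrite -scalemxAl -scalemxAr HsHE (scalerA N%:R^-1 N%:R) mulVf ?pnatr_eq0//.
by rewrite scale1r mulmx_diag.
Qed.

End AlternatingMatrices.

(* Rotating a word cyclically, and merging its two ends when its length is
   odd, leaves at most one factor that is not one of the original ones. *)
Lemma alternating_trace_normal (E : eqType) (b : bool) (s : seq E) :
  (2 <= size s)%N ->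
  exists (l : nat) (es : seq (seq E)) (k0 : nat),
  [/\ size es = l.+1.*2, (k0 < l.+1.*2)%N,
      (forall k, k != k0 -> (k < l.+1.*2)%N ->
         exists x, nth [::] es k = [:: x]) &
      forall (C : numFieldType) n (H Hs : 'M[C]_n.+1) (v : E -> 'rV[C]_n.+1),
        Hs *m H = n.+1%:R%:M ->
        \tr (alternating_prod H Hs b [seq v x | x <- s]) =
        \tr (alternating_prod H Hs true
          [seq \row_i (\prod_(x <- e) v x 0 i) | e <- es])].
Proof.
have single (C : numFieldType) n (v : E -> 'rV[C]_n) (r : seq E) :
    [seq \row_i (\prod_(x <- e) v x 0 i) | e <- [seq [:: x] | x <- r]] =
    [seq v x | x <- r].
  rewrite -map_comp; apply: eq_map => x /=; apply/rowP => i.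
  by rewrite mxE big_seq1.
have nth_single (r : seq E) k : (k < size r)%N ->
    exists x, nth [::] [seq [:: x] | x <- r] k = [:: x].
  by case: r => // x r kr; exists (nth x (x :: r) k); rewrite (nth_map x).
case: s => // x s; case/lastP: s => // s y _.
have [s_odd|s_even] := boolP (odd (size s)).
  exists (size s)./2; have sE : (size s).+2 = (size s)./2.+1.*2.+1.
    by rewrite doubleS -[in LHS](odd_double_half (size s)) s_odd.
  case: b.
    (* Odd word with diagonal ends: [y] is rotated to the front and merged with [x]. *)
    exists ([:: y; x] :: [seq [:: z] | z <- s]), 0%N; split.
    - by rewrite /= size_map; lia.
    - by lia.
    - by case=> // k _ kl; apply: nth_single; lia.
    move=> C n H Hs v HsH; rewrite /= single map_rcons alternating_prod_rcons.
    rewrite size_map s_odd /= mulmxA mxtrace_mulC mulmxA.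
    rewrite (diag_or_conjM HsH true); congr (\tr (diag_or_conj _ _ _ _ *m _)).
    by apply/rowP => i; rewrite !mxE big_cons big_seq1.
  (* Odd word with conjugated ends: [x] is rotated to the back and merged with [y], so that the word
     starts with a diagonal factor. *)
  exists (rcons [seq [:: z] | z <- s] [:: y; x]), (size s); split.
  - by rewrite size_rcons size_map; lia.
  - by lia.
  - move=> k ks kl; rewrite nth_rcons size_map.
    have ks' : (k < size s)%N by lia.
    by rewrite ks'; exact: nth_single.
  move=> C n H Hs v HsH; rewrite /= !map_rcons single !alternating_prod_rcons.
  rewrite size_map s_odd /= mulmxA mxtrace_mulC !mulmxA.
  rewrite mxtrace_mulC (diag_or_conjM HsH false).
  congr (\tr (_ *m diag_or_conj _ _ _ _)).
  by apply/rowP => i; rewrite !mxE big_cons big_seq1.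
exists (size s)./2; have sE : (size s).+2 = (size s)./2.+1.*2.
  by rewrite doubleS -[in LHS](odd_double_half (size s)) (negPf s_even).
case: b.
  exists [seq [:: z] | z <- x :: rcons s y], 0%N; split => //.
  - by rewrite size_map /= size_rcons.
  - by move=> k _ kl; apply: nth_single; rewrite /= size_rcons; lia.
  - by move=> C n H Hs v HsH; rewrite single.
(* Even word starting with a conjugate: rotating [x] to the back makes it start with a diagonal
   factor. All entries are single letters, so any [k0] will do. *)
exists [seq [:: z] | z <- rcons (rcons s y) x], 0%N; split => //.
- by rewrite size_map !size_rcons.
- by move=> k _ kl; apply: nth_single; rewrite !size_rcons; lia.
move=> C n H Hs v HsH; rewrite single [in RHS]map_rcons alternating_prod_rcons.
by rewrite /= mxtrace_mulC size_map size_rcons /= s_even.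
Qed.

Section Hadamard.
Variables (R : realType) (n : nat) (H : 'M[R[i]]_n.+1).
Hypothesis H_hadamard : complex_hadamard H.

Lemma hadamard_mulmx_adj : H *m H^t* = n.+1%:R%:M.
Proof.
have [/unitarymxP HU _] := H_hadamard; move: HU.
have s2 : (Num.sqrt n.+1%:R : R)%:C * (Num.sqrt n.+1%:R)%:C = n.+1%:R :> R[i].
  by rewrite -rmorphM -expr2 sqr_sqrtr ?ler0n// rmorph_nat.
have s0 : (Num.sqrt n.+1%:R : R)%:C != 0 :> R[i].
  apply/eqP => s0; move: s2; rewrite s0 mul0r => /esym/eqP.
  by rewrite pnatr_eq0.
have -> : ((Num.sqrt n.+1%:R)%:C^-1 *: H)^t* = (Num.sqrt n.+1%:R)%:C^-1 *: H^t*.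
  apply/matrixP => i j; rewrite !mxE rmorphM fmorphV /=; congr (_^-1 * _).
  exact: conjc_real.
rewrite -scalemxAl -scalemxAr scalerA -invfM s2 => HU.
by rewrite -[LHS](scalerK (a := n.+1%:R^-1)) ?invr_eq0 ?pnatr_eq0// HU invrK scalemx1.
Qed.

Lemma hadamard_adj_mulmx : H^t* *m H = n.+1%:R%:M.
Proof.
have N0 : n.+1%:R != 0 :> R[i] by rewrite pnatr_eq0.
have : H *m (n.+1%:R^-1 *: H^t*) = 1%:M.
  by rewrite -scalemxAr hadamard_mulmx_adj -scalemx1 scalerA mulVf// scale1r.
move=> /mulmx1C; rewrite -scalemxAl => HH.
by rewrite -[LHS](scalerK (a := n.+1%:R^-1)) ?invr_eq0// HH invrK scalemx1.
Qed.

Lemma hadamard_norm i j : `|H i j| = 1.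
Proof. by have [_] := H_hadamard. Qed.

Lemma hadamard_adj_norm i j : `|H^t* i j| = 1.
Proof. by rewrite !mxE norm_conjC hadamard_norm. Qed.

End Hadamard.

Section AlternatingEstimate.
Context d (T : measurableType d) (R : realType) (P : probability T R).
Context d' (S : measurableType d') (E : eqType).
Local Notation C := R[i].

Lemma cLinf_mulmx m n p (A : T -> 'M[C]_(m, n)) (B : T -> 'M[C]_(n, p)) :
  (forall i j, cLinf P (fun t => A t i j)) ->
  (forall i j, cLinf P (fun t => B t i j)) ->
  forall i j, cLinf P (fun t => (A t *m B t) i j).
Proof.
move=> AL BL i j; under eq_fun do rewrite mxE.
by apply: cLinf_sum => k; exact: cLinfM.
Qed.

Variables (xi : nat -> T -> S) (F : E -> S -> R).
Hypothesis xi_indep : independent_seq P xi.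
Hypothesis xi_measurable : forall p, measurable_fun setT (xi p).
Hypothesis F_measurable : forall x, measurable_fun setT (F x).
Hypothesis F_bounded : forall x, exists M, forall p, \forall t \ae P, `|F x (xi p t)| <= M.
Hypothesis F_centered : forall x p, \int[P]_t F x (xi p t) = 0.

Lemma alternating_estimate (b : bool) (s : seq E) : (2 <= size s)%N ->
  exists c : R, forall n (H : 'M[C]_n.+1), complex_hadamard H ->
  `|n.+1%:R^-1 * cexpectation P (fun t => \tr (alternating_prod H (H^t*) b
      [seq \row_i (F x (xi i t))%:C | x <- s]))| <= (c / n.+1%:R)%:C.
Proof.
move=> /(alternating_trace_normal b)[l [es [k0 [es_size k0l es1 trE]]]].
pose f k z := \prod_(x <- nth [::] es k) F x z.
have fm k : measurable_fun setT (f k).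
  rewrite /f; elim: (nth _ _ _) => [|x e IHe].
    by under eq_fun do rewrite big_nil; exact: measurable_cst.
  by under eq_fun do rewrite big_cons; exact: measurable_funM.
have fb k : exists M, forall p, \forall t \ae P, `|f k (xi p t)| <= M.
  rewrite /f; elim: (nth _ _ _) => [|x e [M eM]].
    by exists 1 => p; apply: nearW => t; rewrite big_nil normr1.
  have [M' xM'] := F_bounded x; exists (M' * M) => p.
  apply: filterS2 (eM p) (xM' p) => t etM xtM'.
  by rewrite big_cons normrM ler_pM.
have [Mf fMf] := boolp.choice fb.
(* The summand 1 covers the positions beyond [es], where [f k] is the empty product. *)
pose M := 1 + \sum_(k < size es) `|Mf k|.
have fM k p : \forall t \ae P, `|f k (xi p t)| <= M.
  have [kes|kes] := ltnP k (size es); last first.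
    apply: nearW => t; rewrite /f nth_default// big_nil normr1 lerDl.
    by apply: sumr_ge0.
  apply: filterS (fMf k p) => t /le_trans; apply.
  rewrite (le_trans (ler_norm _))// /M (bigD1 (Ordinal kes))//= addrCA lerDl.
  by rewrite addr_ge0 ?ler01 ?sumr_ge0.
(* The count N^(l+1) of index maps cancels the factor N^-(l+1) of the conjugates, so the
   normalization of the trace leaves exactly c / N. *)
exists ((l.+1 ^ l.+1.*2)%:R * M ^+ l.+1.*2) => n H HH.
have trE' t : \tr (alternating_prod H (H^t*) b
      [seq \row_i (F x (xi i t))%:C | x <- s]) =
    n.+1%:R ^- l.+1 * \tr (\prod_(k < l.+1.*2)
      (diag_mx (\row_(i < n.+1) (f k (xi i t))%:C) *m
       (if odd k then H^t* else H))).
  rewrite (trE _ _ _ _ (fun x => \row_i (F x (xi i t))%:C)); last first.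
    exact: hadamard_adj_mulmx.
  rewrite (@alternating_prod_double _ _ _ _ l.+1) ?size_map// mxtraceZ.
  congr (_ * \tr _); apply: eq_bigr => k _; congr (diag_mx _ *m _).
  rewrite (nth_map [::]) ?es_size//; apply/rowP => i; rewrite !mxE.
  by rewrite rmorph_prod; apply: eq_bigr => x _; rewrite mxE.
under [X in cexpectation P X]eq_fun do rewrite trE'.
have hn k i j : `|(if odd k then H^t* else H) i j| = 1.
  by case: odd; [exact: hadamard_adj_norm|exact: hadamard_norm].
have fL := f_Linf xi_measurable fm fM.
rewrite cexpectationZ; last first.
  suff AL m i j : cLinf P (fun t => (\prod_(k < m)
      (diag_mx (\row_(i < n.+1) (f k (xi i t))%:C) *m
       (if odd k then H^t* else H))) i j) by exact: cLinf_sum.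
  elim: m i j => [|m IHm] i j.
    by under eq_fun do rewrite big_ord0; exact: cLinf_cst.
  under eq_fun do rewrite big_ord_recr/= -mulmxE.
  apply: cLinf_mulmx; [exact: IHm|] => {}i {}j.
  apply: cLinf_mulmx => {}i {}j.
    under eq_fun do rewrite !mxE; case: eqP => _; last exact: cLinf_cst.
    by under eq_fun do rewrite mulr1n; apply: cLinf_real; exact: fL.
  exact: cLinf_cst.
have f0 k p : k != k0 -> (k < l.+1.*2)%N -> \int[P]_t f k (xi p t) = 0.
  move=> kk0 kl; have [x kx] := es1 k kk0 kl.
  rewrite -[RHS](F_centered x p).
  by apply: eq_Rintegral => t _; rewrite /f kx big_seq1.
have est := trace_estimate xi_indep xi_measurable fm fM (k0 := Ordinal k0l) hn f0.
rewrite !normrM !normfV normrX.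
rewrite normr_nat; apply: (le_trans (ler_wpM2l _ (ler_wpM2l _ est))).
- by rewrite invr_ge0 ler0n.
- by rewrite invr_ge0 exprn_ge0// ler0n.
rewrite -(rmorph_nat (real_complex R)) -rmorphXn -!fmorphV -!rmorphM lecR.
rewrite natrM !natrX; rewrite le_eqVlt; apply/orP; left; apply/eqP.
have x0 : n.+1%:R != 0 :> R by rewrite pnatr_eq0.
move: (n.+1%:R) x0 => x x0; have xl : x ^+ l.+1 != 0 by rewrite expf_neq0.
by field; rewrite xl x0.
Qed.

End AlternatingEstimate.

(** * Convergence of the joint law *)

Lemma cvgn_lin (K : numFieldType) (c a b : K) (u v : nat -> K) :
  (u n : K^o) @[n --> \oo] --> (a : K^o) ->
  (v n : K^o) @[n --> \oo] --> (b : K^o) ->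
  (c * u n + v n : K^o) @[n --> \oo] --> (c * a + b : K^o).
Proof. by move=> ua vb; apply: cvgD => //; exact: cvgMr. Qed.

Arguments cvgn_lin {K} c {a b u v}.

Section LimitState.
Variable R : realType.
Local Notation C := R[i].

Lemma cvg0_divn (u : nat -> C) (c : R) :
  (forall n, `|u n| <= (c / n.+1%:R)%:C) -> (u n : C^o) @[n --> \oo] --> (0 : C^o).
Proof.
move=> uc; apply/cvgrPdist_lt => e e0.
have [/eqP Ime Ree] : complex.Im e == 0 /\ 0 < complex.Re e.
  by move: e0; rewrite ltcE => /andP[].
have /cvgrPdist_lt/(_ _ Ree) : (c * harmonic n : R) @[n --> \oo] --> (0 : R).
  by rewrite -(mulr0 c); apply: cvgMr; exact: cvg_harmonic.
apply: filterS => n; rewrite sub0r normrN => cn; rewrite sub0r normrN.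
apply: (le_lt_trans (uc n)); rewrite ltcE /= Ime eqxx /=.
exact: le_lt_trans (ler_norm _) cn.
Qed.

Lemma cvgC_unique (u : nat -> C) (a b : C) :
  (u n : C^o) @[n --> \oo] --> (a : C^o) ->
  (u n : C^o) @[n --> \oo] --> (b : C^o) -> a = b.
Proof. by move=> ua ub; apply: (cvg_unique _ ua ub). Qed.

Lemma cvgC_lim (u : nat -> C) (a : C) :
  (u n : C^o) @[n --> \oo] --> (a : C^o) -> lim ((u n : C^o) @[n --> \oo]) = a.
Proof. by move=> ua; apply: cvg_lim. Qed.

Lemma ncstate_exists (A : algType C) (f : A -> C) :
  scalar f -> f 1 = 1 -> exists phi : ncstate A, phi =1 f.
Proof.
move=> fL f1.
pose F : {scalar A} := HB.pack_for {scalar A} f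
  (GRing.isLinear.Build C A C _ f fL).
by exists (@NCState R A F f1).
Qed.

(** The polynomials whose joint moments converge form a subspace. The individual moments are the
    same for every [n], so one centering serves all [n], and the subspace contains the centered
    alternating products. *)
Lemma limit_state (I : choiceType) (A : nat -> algType C)
    (phi : forall n, ncstate (A n)) (a : forall n, I -> A n) (m : I -> nat -> C) :
  (forall n i k, phi n (a n i ^+ k) = m i k) ->
  (forall s : seq (I * nat), (2 <= size s)%N ->
     sorted (fun x y => x.1 != y.1) s ->
     (phi n (\prod_(x <- s) (a n x.1 ^+ x.2 - (m x.1 x.2)%:A)) : C^o)
       @[n --> \oo] --> (0 : C^o)) ->
  exists tau : ncstate (ncpoly C I),
    [/\ forall f, (joint_law (phi n) (a n) f : C^o) @[n --> \oo] --> (tau f : C^o),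
        free_elements tau (@ncX C I) &
        forall i k, tau (ncX C i ^+ k) = m i k].
Proof.
move=> phi_m phi0.
have ev n (s : seq (I * nat)) : nceval (a n) (\prod_(x <- s)
      (ncX C x.1 ^+ x.2 - (m x.1 x.2)%:A)) =
    \prod_(x <- s) (a n x.1 ^+ x.2 - (m x.1 x.2)%:A).
  rewrite rmorph_prod; apply: eq_bigr => x _ /=.
  by rewrite rmorphB rmorphXn /= ncevalX linearZ rmorph1.
have phi_cvg f : exists l : C,
    (joint_law (phi n) (a n) f : C^o) @[n --> \oo] --> (l : C^o).
  move: f; apply: (@ncpoly_alternating_ind _ _ m [set f | exists l : C,
    (joint_law (phi n) (a n) f : C^o) @[n --> \oo] --> (l : C^o)]).
    move=> c f g [lf fE] [lg gE]; exists (c * lf + lg).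
    have := cvgn_lin c fE gE; apply: cvg_trans; apply: near_eq_cvg.
    by apply: nearW => n; rewrite /joint_law !linearP.
  move=> s s_alt /=.
  suff [l phi_l] : exists l : C,
      (phi n (\prod_(x <- s) (a n x.1 ^+ x.2 - (m x.1 x.2)%:A)) : C^o)
        @[n --> \oo] --> (l : C^o).
    exists l; apply: cvg_trans phi_l; apply: near_eq_cvg; apply: nearW => n.
    by congr (phi n _); exact/esym/ev.
  case: s s_alt => [|x [|y s]] s_alt.
  - exists 1; under eq_fun do rewrite big_nil ncstate1; exact: cvg_cst.
  - exists 0; under eq_fun do rewrite big_seq1 ncstateB_cst phi_m subrr.
    exact: cvg_cst.
  - by exists 0; exact: phi0.
pose tau f : C := lim ((joint_law (phi n) (a n) f : C^o) @[n --> \oo]).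
have tauP f : (joint_law (phi n) (a n) f : C^o) @[n --> \oo] --> (tau f : C^o).
  by have [l fl] := phi_cvg f; rewrite /tau (cvgC_lim fl).
have tau_eq f l : (forall n, joint_law (phi n) (a n) f = l) -> tau f = l.
  move=> fl; apply: cvgC_unique (tauP f) _.
  by under eq_fun do rewrite fl; exact: cvg_cst.
have tauL : scalar tau.
  move=> c f g; apply: cvgC_unique (tauP _) _.
  apply: cvg_trans (cvgn_lin c (tauP f) (tauP g)); apply: near_eq_cvg.
  by apply: nearW => n; rewrite /joint_law !linearP.
have tau1 : tau 1 = 1.
  by apply: tau_eq => n; rewrite /joint_law rmorph1 ncstate1.
have tauX i k : tau (ncX C i ^+ k) = m i k.
  by apply: tau_eq => n; rewrite /joint_law rmorphXn /= ncevalX phi_m.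
have [psi psiE] := ncstate_exists tauL tau1.
exists psi; split=> [f||i k]; rewrite ?psiE//.
apply/free_elementsP => s s2 s_alt.
have -> : \prod_(x <- s) (ncX C x.1 ^+ x.2 - (psi (ncX C x.1 ^+ x.2))%:A) =
    \prod_(x <- s) (ncX C x.1 ^+ x.2 - (m x.1 x.2)%:A).
  by apply: eq_bigr => x _; congr (_ - _%:A); rewrite psiE tauX.
rewrite psiE; apply: cvgC_unique (tauP _) _.
apply: cvg_trans (phi0 _ s2 s_alt); apply: near_eq_cvg; apply: nearW => n.
by congr (phi n _); exact/esym/ev.
Qed.

End LimitState.

Section DiagOrConj.
Variables (C : numFieldType) (n : nat) (H Hs : 'M[C]_n.+1).
Local Notation N := n.+1.
Hypothesis HsH : Hs *m H = N%:R%:M.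
Hypothesis HHs : H *m Hs = N%:R%:M.
Local Notation D := (diag_or_conj H Hs).

Lemma diag_or_conj_cst b (c : C) : D b (\row_i c) = c%:M.
Proof.
have -> : \row_(i < N) c = const_mx c by apply/rowP => i; rewrite !mxE.
case: b; rewrite /= diag_const_mx// mul_mx_scalar -scalemxAl HHs.
by rewrite scalerA mulrC -scalerA scalerA scale_scalar_mx mulfVK ?pnatr_eq0.
Qed.

Lemma diag_or_conjDZ b (u v : 'rV[C]_N) (e : C) :
  D b u + e *: D b v = D b (u + e *: v).
Proof.
have DZ : diag_mx (u + e *: v) = diag_mx u + e *: diag_mx v.
  by rewrite raddfD /=; congr (_ + _); rewrite linearZ.
case: b; rewrite /= DZ// mulmxDr mulmxDl scalerDr -scalemxAr -scalemxAl.
by rewrite !scalerA [e * _]mulrC.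
Qed.

Lemma diag_or_conjX b (v : 'rV[C]_N) k : D b v ^+ k = D b (\row_i (v 0 i ^+ k)).
Proof.
elim: k => [|k IHk].
  transitivity (D b (\row_i 1)); first by rewrite diag_or_conj_cst.
  by congr (D b _); apply/rowP => i; rewrite !mxE.
rewrite exprS IHk -mulmxE diag_or_conjM//; congr (D b _).
by apply/rowP => i; rewrite !mxE exprS.
Qed.

Lemma mxtrace_diag_or_conj b (v : 'rV[C]_N) : \tr (D b v) = \sum_i v 0 i.
Proof.
rewrite -mxtrace_diag; case: b => //=.
rewrite mxtraceZ mxtrace_mulC mulmxA HsH mul_scalar_mx mxtraceZ mulrA.
by rewrite mulVf ?mul1r ?pnatr_eq0.
Qed.

Lemma alternating_prod_path (E : Type) (v : bool * E -> 'rV[C]_N) x s :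
  path (fun x y => x.1 != y.1) x s ->
  \prod_(y <- s) D y.1 (v y) = alternating_prod H Hs (~~ x.1) [seq v y | y <- s].
Proof.
elim: s x => [|y s IHs] x /=; first by rewrite big_nil.
case/andP => xy /IHs ys; rewrite big_cons ys; have -> : y.1 = ~~ x.1.
  by case: (x.1) (y.1) xy => [] [].
by rewrite negbK mulmxE.
Qed.

End DiagOrConj.

Lemma ncevalM (K : comNzRingType) (I : choiceType) (A : algType K) (a : I -> A)
    (f g : ncpoly K I) : nceval a (f * g) = nceval a f * nceval a g.
Proof. exact: rmorphM. Qed.

Lemma nceval_binomial (K : comNzRingType) (I : choiceType) (A : algType K)
    (a : I -> A) (c e : K) i k :
  nceval a (c%:A + e *: ncX K i ^+ k) = c%:A + e *: a i ^+ k.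
Proof.
rewrite linearD; congr (_ + _); rewrite linearZ /=; congr (_ *: _).
  exact: rmorph1.
by rewrite rmorphXn /= ncevalX.
Qed.

Lemma nceval_lrmorph (K : comNzRingType) (I : choiceType) (A B : algType K)
    (g : {lrmorphism A -> B}) (a : I -> A) (f : ncpoly K I) :
  g (nceval a f) = nceval (fun i => g (a i)) f.
Proof.
move: f; apply: (@ncpoly_ind _ _ [set f |
  g (nceval a f) = nceval (fun i => g (a i)) f]) => [c f h fE hE|w] /=.
  by rewrite !linearP /= fE hE.
by rewrite !rmorph_prod; apply: eq_bigr => i _; rewrite /= !ncevalX.
Qed.

Lemma joint_law_tracial (R : realType) (I : choiceType) (A : algType R[i])
    (phi : ncstate A) (a : I -> A) : tracial phi ->
  forall f g, joint_law phi a (f * g) = joint_law phi a (g * f).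
Proof.
move=> phiC f g; apply: etrans (congr1 phi (ncevalM a f g)) _.
exact: etrans (phiC _ _) (congr1 phi (esym (ncevalM a g f))).
Qed.

Section RandomMatrixEvaluation.
Context d (T : measurableType d) (R : realType) (P : probability T R) (n : nat).
Local Notation C := R[i].

(** Evaluation at a sample point, named so as to carry the structure of an algebra morphism; it
    reduces identities between random matrices to deterministic ones. *)
Definition rmx_eval (t : T) (A : rmx P n) : 'M[C]_n.+1 := A t.

Lemma rmx_eval_linear t : linear (rmx_eval t).
Proof. by []. Qed.

Lemma rmx_eval_monoid_morphism t : monoid_morphism (rmx_eval t).
Proof. by []. Qed.

HB.instance Definition _ t := GRing.isLinear.Build C (rmx P n) 'M[C]_n.+1 _
  (rmx_eval t) (rmx_eval_linear t).
HB.instance Definition _ t := GRing.isMonoidMorphism.Build (rmx P n) 'M[C]_n.+1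
  (rmx_eval t) (rmx_eval_monoid_morphism t).

Lemma rmx_stateE (A : rmx P n) : rmx_state P n A =
  n.+1%:R^-1 * cexpectation P (fun t => \tr (rmx_eval t A)).
Proof. by []. Qed.

Lemma rmx_state_tracial : tracial (rmx_state P n).
Proof.
move=> A B; suff e : (fun t => \tr ((A * B) t)) = (fun t => \tr ((B * A) t)).
  exact: (congr1 (fun u => n.+1%:R^-1 * cexpectation P u) e).
by apply/funext => t; exact: (mxtrace_mulC (A t) (B t)).
Qed.

Lemma rmx_eval_nceval (I : choiceType) (a : I -> rmx P n) (f : ncpoly C I) t :
  rmx_eval t (nceval a f) = nceval (fun i => rmx_eval t (a i)) f.
Proof. exact: (nceval_lrmorph (rmx_eval t)). Qed.

End RandomMatrixEvaluation.

(** * Asymptotic freeness of the random matrix model *)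

Section DiagonalModel.
Context d (T : measurableType d) (R : realType) (P : probability T R).
Local Notation C := R[i].
Variables (U V : nat -> T -> R) (M : R) (mU mV : nat -> R).
Variable H : forall n, 'M[C]_n.+1.
Hypothesis UL : forall i, U i \in Lfun P +oo%E.
Hypothesis VL : forall i, V i \in Lfun P +oo%E.
Hypothesis U_bounded : forall i, \forall t \ae P, `|U i t| <= M.
Hypothesis V_bounded : forall i, \forall t \ae P, `|V i t| <= M.
Hypothesis U_moment : forall i k, \int[P]_t (U i t ^+ k) = mU k.
Hypothesis V_moment : forall i k, \int[P]_t (V i t ^+ k) = mV k.
Hypothesis UV_indep : independent_seq P (fun i => rv_pair (U i) (V i)).
Hypothesis H_hadamard : forall n, complex_hadamard (H n).

Definition diag_model n : bool -> rmx P n :=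
  pair_family (rmx_diag n UL) (n.+1%:R^-1 *:
    (rmx_cst P (H n) * rmx_diag n VL * rmx_cst P ((H n)^t*))).

Let W (b : bool) := if b then U else V.
Let m (b : bool) := if b then mU else mV.

Lemma diag_modelE n b t : rmx_eval t (diag_model n b) =
  diag_or_conj (H n) ((H n)^t*) b (\row_i (W b i t)%:C).
Proof. by case: b. Qed.

Let HsH n := hadamard_adj_mulmx (H_hadamard n).
Let HHs n := hadamard_mulmx_adj (H_hadamard n).

Lemma diag_modelX n b k t : rmx_eval t (diag_model n b ^+ k) =
  diag_or_conj (H n) ((H n)^t*) b (\row_i (W b i t ^+ k)%:C).
Proof.
rewrite rmorphXn /= diag_modelE (diag_or_conjX (HsH n) (HHs n)).
by congr diag_or_conj; apply/rowP => i; rewrite !mxE rmorphXn.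
Qed.

Lemma diag_model_centered n b k (c : R) t :
  rmx_eval t (diag_model n b ^+ k - (c%:C)%:A) =
  diag_or_conj (H n) ((H n)^t*) b (\row_i (W b i t ^+ k - c)%:C).
Proof.
have -> : rmx_eval t (diag_model n b ^+ k - (c%:C)%:A) =
    rmx_eval t (diag_model n b ^+ k) - (c%:C)%:M by rewrite -scalemx1.
rewrite diag_modelX -(diag_or_conj_cst (HHs n) b) -scaleN1r.
rewrite diag_or_conjDZ; congr diag_or_conj.
by apply/rowP => i; rewrite !mxE mulN1r rmorphB.
Qed.

Lemma W_Linf b i : W b i \in Lfun P +oo%E.
Proof. by case: b; [exact: UL|exact: VL]. Qed.

(** The individual moments are exact at every size: conjugation by [H] divided by the square root of
    N preserves the trace, and the diagonal entries share their moments. *)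
Lemma diag_model_moment n b k :
  rmx_state P n (diag_model n b ^+ k) = (m b k)%:C.
Proof.
rewrite rmx_stateE (_ : (fun t => _) =
    (fun t => \sum_(i < n.+1) (W b i t ^+ k)%:C * 1)); last first.
  apply/funext => t; rewrite diag_modelX mxtrace_diag_or_conj//.
  by apply: eq_bigr => i _; rewrite mxE mulr1.
have WL (i : 'I_n.+1) : (fun t => W b i t ^+ k) \in Lfun P +oo%E.
  by apply: LinfX; exact: W_Linf.
rewrite (cexpectation_sum _ _ WL).
under eq_bigr => i _.
  rewrite mulr1 (_ : \int[P]_t _ = m b k); last first.
    by case: (b); [exact: U_moment|exact: V_moment].
  over.
rewrite sumr_const card_ord mulrnAr -mulrnAl -[_^-1 *+ _]mulr_natr.
by rewrite mulVf ?mul1r ?pnatr_eq0.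
Qed.

Theorem diag_model_limit : exists tau : ncstate (ncpoly C bool),
  [/\ forall f, (joint_law (rmx_state P n) (diag_model n) f : C^o)
        @[n --> \oo] --> (tau f : C^o),
      free_elements tau (@ncX C bool) &
      forall b k, tau (ncX C b ^+ k) = (m b k)%:C].
Proof.
apply: limit_state => [|s s2 s_alt]; first exact: diag_model_moment.
(* The independent objects are the pairs, so each letter is a function of a pair and selects the
   coordinate it depends on. *)
pose F (x : bool * nat) (p : R * R) : R :=
  (if x.1 then p.1 else p.2) ^+ x.2 - m x.1 x.2.
have FE x i t : F x (rv_pair (U i) (V i) t) = W x.1 i t ^+ x.2 - m x.1 x.2.
  by case: x => [] [].
have xi_measurable p : measurable_fun setT (rv_pair (U p) (V p)).
  by apply: measurable_fun_pair; exact: Linf_measurable.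
have F_measurable x : measurable_fun setT (F x).
  apply: measurable_funB; last exact: measurable_cst.
  by apply: measurable_funX; case: (x.1);
    [exact: measurable_fst|exact: measurable_snd].
have F_bounded x : exists M', forall p, \forall t \ae P,
    `|F x (rv_pair (U p) (V p) t)| <= M'.
  exists (M ^+ x.2 + `|m x.1 x.2|) => p.
  have : \forall t \ae P, `|W x.1 p t| <= M by case: (x.1).
  apply: filterS => t WM; rewrite FE (le_trans (ler_normB _ _))// lerD2r.
  by rewrite normrX lerXn2r// ?nnegrE// (le_trans _ WM).
have F_centered x p : \int[P]_t F x (rv_pair (U p) (V p) t) = 0.
  under eq_Rintegral do rewrite FE.
  rewrite RexpectationB ?Rexpectation_cst; first last.
  - exact: Linf_cst.
  - by apply: LinfX; exact: W_Linf.
  by rewrite /m; case: (x.1); rewrite /W ?U_moment ?V_moment subrr.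
have [c est] := alternating_estimate UV_indep xi_measurable F_measurable
  F_bounded F_centered (head true (map fst s)) s2.
apply: (@cvg0_divn _ _ c) => n; apply: le_trans (est n (H n) (H_hadamard n)).
rewrite rmx_stateE le_eqVlt; apply/orP; left; apply/eqP; congr (`|_ * _|).
congr cexpectation; apply/funext => t; congr (\tr _).
rewrite rmorph_prod; case: s s2 s_alt est => // x s _ /= s_alt _.
pose v (y : bool * nat) : 'rV[C]_n.+1 :=
  \row_i (F y (rv_pair (U i) (V i) t))%:C.
have DE y : rmx_eval t (diag_model n y.1 ^+ y.2 - ((m y.1 y.2)%:C)%:A) =
    diag_or_conj (H n) ((H n)^t*) y.1 (v y).
  rewrite diag_model_centered; congr diag_or_conj.
  by apply/rowP => i; rewrite !mxE FE.
rewrite (eq_bigr _ (fun y _ => DE y)) big_cons -mulmxE; congr (_ *m _).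
exact: alternating_prod_path.
Qed.

End DiagonalModel.

(** * Positivity of the limit state *)

Section MatrixStar.
Variables (R : realType) (n : nat).
Local Notation C := R[i].

Lemma mxtrmxC_is_star : is_star (fun A : 'M[C]_n.+1 => A^t*).
Proof.
split=> [A|A B|z A|A B]; apply/matrixP => i j; rewrite !mxE.
- exact: conjCK.
- exact: rmorphD.
- exact: rmorphM.
- by rewrite rmorph_sum; apply: eq_bigr => k _; rewrite !mxE rmorphM mulrC.
Qed.

Lemma diag_or_conj_adj (H : 'M[C]_n.+1) b (v : 'rV[R]_n.+1) :
  (diag_or_conj H (H^t*) b (\row_i (v 0 i)%:C))^t* =
  diag_or_conj H (H^t*) b (\row_i (v 0 i)%:C).
Proof.
have [trK _ trZ trM'] := mxtrmxC_is_star.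
have trM (A B : 'M[C]_n.+1) : (A *m B)^t* = B^t* *m A^t* := trM' A B.
have DE : (diag_mx (\row_i (v 0 i)%:C) : 'M[C]_n.+1)^t* =
    diag_mx (\row_i (v 0 i)%:C).
  apply/matrixP => i j; rewrite !mxE eq_sym; case: eqP => [->|_].
    by rewrite !mulr1n; exact: conjc_real.
  by rewrite !mulr0n rmorph0.
case: b => //=; rewrite trZ !trM trK DE mulmxA.
by rewrite fmorphV rmorph_nat.
Qed.

Lemma mxtrace_diag_or_conj_ge0 (H F : 'M[C]_n.+1) b (v : 'rV[C]_n.+1) :
  (forall i, 0 <= v 0 i) ->
  0 <= \tr (F^t* *m diag_or_conj H (H^t*) b v *m F).
Proof.
move=> v0; have diag_ge0 (G : 'M[C]_n.+1) : 0 <= \tr (G^t* *m diag_mx v *m G).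
  apply: sumr_ge0 => i _; rewrite mxE; apply: sumr_ge0 => j _.
  rewrite mul_mx_diag !mxE mulrAC mulr_ge0// mulrC.
  by rewrite -normCK exprn_ge0.
case: b => //=; rewrite -scalemxAr -scalemxAl mxtraceZ.
apply: mulr_ge0; first by rewrite invr_ge0 ler0n.
have [trK _ _ trM'] := mxtrmxC_is_star.
have trM (A B : 'M[C]_n.+1) : (A *m B)^t* = B^t* *m A^t* := trM' A B.
(* The conjugated case is the diagonal one with [H^t* *m F] in place of [F]. *)
have := diag_ge0 (H^t* *m F).
by rewrite trM trK !mulmxA.
Qed.

End MatrixStar.

Section CvgPositive.
Variable R : realType.
Local Notation C := R[i].

(** The order is only partial here, so nonnegativity passes to the limit through the continuity of
    the norm, in the form |u| = u. *)
Lemma cvgn_ge0 (K : numFieldType) (u : nat -> K) (l : K) : (forall n, 0 <= u n) ->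
  (u n : K^o) @[n --> \oo] --> (l : K^o) -> 0 <= l.
Proof.
move=> u0 ul; suff <- : `|l| = l by exact: normr_ge0.
have uE : (fun n => `|u n|) = u by apply/funext => n; rewrite ger0_norm.
have := @cvg_norm _ K^o _ _ _ _ _ ul; rewrite uE => ul'.
by apply: (cvg_unique _ (ul' _) ul).
Qed.

Context d (T : measurableType d) (P : probability T R).

Lemma cexpectation_ge0 (g : T -> C) : cLinf P g ->
  (\forall t \ae P, 0 <= g t) -> 0 <= cexpectation P g.
Proof.
move=> /andP[g1 g2] g0; rewrite lecE /=; apply/andP; split.
  rewrite -(Rexpectation_cst P 0); apply/eqP; apply: ae_eq_Rexpectation => //.
    exact: Linf_cst.
  by apply: filterS g0 => t; rewrite lecE /= => /andP[/eqP].
rewrite -(Rexpectation_cst P 0); apply: ae_le_Rexpectation => //.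
  exact: Linf_cst.
by apply: filterS g0 => t; rewrite lecE /= => /andP[].
Qed.

Lemma rmx_state_ge0 n (A : rmx P n) :
  (\forall t \ae P, 0 <= \tr (rmx_eval t A)) -> 0 <= rmx_state P n A.
Proof.
move=> A0; rewrite rmx_stateE; apply: mulr_ge0.
  by rewrite invr_ge0 ler0n.
by apply: cexpectation_ge0 => //; exact: rmx_trace_Linf.
Qed.

End CvgPositive.

Section LimitPositive.
Context d (T : measurableType d) (R : realType) (P : probability T R).
Local Notation C := R[i].
Variables (U V : nat -> T -> R) (M : R).
Variable H : forall n, 'M[C]_n.+1.
Hypothesis UL : forall i, U i \in Lfun P +oo%E.
Hypothesis VL : forall i, V i \in Lfun P +oo%E.
Hypothesis U_bounded : forall i, \forall t \ae P, `|U i t| <= M.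
Hypothesis V_bounded : forall i, \forall t \ae P, `|V i t| <= M.
Hypothesis H_hadamard : forall n, complex_hadamard (H n).
Variable tau : ncstate (ncpoly C bool).
Hypothesis tauP : forall f,
  (joint_law (rmx_state P n) (diag_model H UL VL n) f : C^o)
    @[n --> \oo] --> (tau f : C^o).

Lemma limit_tracial : tracial tau.
Proof.
move=> f g; apply: cvgC_unique (@tauP _) _.
apply: cvg_trans (@tauP (g * f)); apply: near_eq_cvg; apply: nearW => n.
by apply: joint_law_tracial; exact: rmx_state_tracial.
Qed.

(** A common source for the positivity of the state (c = 1, e = 0), the bounds on a generator (k =
    1) and the bound on its fourth power. Finitely many entries are bounded simultaneously almost
    surely, and there the middle factor is a positive semidefinite matrix. *)
Lemma limit_positive (c e : R) k b (f : ncpoly C bool) :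
  (forall w, `|w| <= M -> 0 <= c + e * w ^+ k) ->
  0 <= tau (ncstar f * ((c%:C)%:A + e%:C *: ncX C b ^+ k) * f).
Proof.
move=> ce0; apply: cvgn_ge0 (@tauP _) => n; rewrite /joint_law.
apply: rmx_state_ge0; pose W := if b then U else V.
have : \forall t \ae P, forall i : 'I_n.+1, `|W i t| <= M.
  by apply: filter_forall => i; rewrite /W; case: (b).
apply: filterS => t WM.
pose B i := rmx_eval t (diag_model H UL VL n i).
have BE i : B i =
    diag_or_conj (H n) ((H n)^t*) i (\row_j ((if i then U else V) j t)%:C).
  exact: diag_modelE.
have Bsa i : (B i)^t* = B i.
  have := diag_or_conj_adj (H n) i (\row_j (if i then U else V) j t).
  by under eq_mx do rewrite mxE; rewrite -BE.
have HsH := hadamard_adj_mulmx (H_hadamard n).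
have HHs := hadamard_mulmx_adj (H_hadamard n).
have -> : rmx_eval t (nceval (diag_model H UL VL n)
      (ncstar f * ((c%:C)%:A + e%:C *: ncX C b ^+ k) * f)) =
    (nceval B f)^t* *m
    diag_or_conj (H n) ((H n)^t*) b (\row_i (c + e * W i t ^+ k)%:C) *m
    nceval B f.
  have -> : rmx_eval t (nceval (diag_model H UL VL n)
        (ncstar f * ((c%:C)%:A + e%:C *: ncX C b ^+ k) * f)) =
      nceval B (ncstar f) * nceval B ((c%:C)%:A + e%:C *: ncX C b ^+ k) *
      nceval B f.
    apply: etrans (rmx_eval_nceval _ _ _) _.
    apply: etrans (ncevalM _ _ _) _; congr (_ * _); exact: ncevalM.
  rewrite (nceval_star _ (mxtrmxC_is_star R n) Bsa) -!mulmxE.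
  congr (_ *m _ *m _).
  rewrite nceval_binomial -[(c%:C)%:A]/(c%:C *: 1%:M) scalemx1.
  rewrite BE diag_or_conjX// -(diag_or_conj_cst HHs b) diag_or_conjDZ.
  congr diag_or_conj; apply/rowP => i.
  by rewrite !mxE rmorphD rmorphM rmorphXn /W; case: (b).
apply: mxtrace_diag_or_conj_ge0 => i; rewrite mxE ler0c.
exact: ce0.
Qed.

End LimitPositive.

(** * The Hausdorff moment problem *)

Section BernsteinWeights.
Variables (R : realType) (L : {poly R} -> R).
Hypothesis L_scalar : scalar L.
Hypothesis L1 : L 1 = 1.
Hypothesis L_ge0 : forall j l, 0 <= L ('X^j * (1 - 'X) ^+ l).

Let LE : exists F : {scalar {poly R}}, F =1 L.
Proof.
by exists (HB.pack_for {scalar {poly R}} L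
  (GRing.isLinear.Build R {poly R} R _ L L_scalar)).
Qed.

(** These are the factorial moments of the binomial distribution, that is, x^k times the k-th
    derivative in x of (x + y)^n. *)
Lemma bernstein_ffact (A : comNzRingType) (x y : A) n k : (k <= n)%N ->
  \sum_(j < n.+1) (x ^+ j * y ^+ (n - j)) *+ ('C(n, j) * j ^_ k) =
  (x ^+ k * (x + y) ^+ (n - k)) *+ n ^_ k.
Proof.
elim: k n => [|k IHk] n kn.
  rewrite ffactn0 mulr1n subn0 mul1r [x + y]addrC exprDn; apply: eq_bigr => j _.
  by rewrite ffactn0 muln1 mulrC.
case: n kn => // n kn; rewrite big_ord_recl ffact0n muln0 mulr0n add0r.
have coefE j : ('C(n.+1, j.+1) * j.+1 ^_ k.+1 = 'C(n, j) * j ^_ k * n.+1)%N.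
  by rewrite ffactSS mulnCA mulnA -mul_bin_diag -mulnA mulnC.
rewrite subSS ffactSS mulnC mulrnA exprS -mulrA -mulrnAr -IHk// mulr_sumr.
rewrite -sumrMnl; apply: eq_bigr => j _.
by rewrite lift0 coefE subSS exprS -mulrA mulrnA mulrnAr.
Qed.

(** The value of [L] at a Bernstein polynomial, to be used as a mass at j / n. *)
Definition bernstein_weight n j := L ('X^j * (1 - 'X) ^+ (n - j)) *+ 'C(n, j).

Lemma bernstein_weight_ge0 n j : 0 <= bernstein_weight n j.
Proof. by rewrite mulrn_wge0. Qed.

Lemma bernstein_weight_ffact n k : (k <= n)%N ->
  \sum_(j < n.+1) bernstein_weight n j * (j ^_ k)%:R = L 'X^k * (n ^_ k)%:R.
Proof.
have [F FE] := LE; move=> kn.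
have XkE : F (\sum_(j < n.+1) ('X^j * (1 - 'X) ^+ (n - j)) *+
    ('C(n, j) * j ^_ k)) = F 'X^k *+ n ^_ k.
  by rewrite bernstein_ffact// (addrC 'X) subrK expr1n mulr1 raddfMn.
rewrite -FE mulr_natr -XkE raddf_sum; apply: eq_bigr => j _.
by rewrite raddfMn /= FE mulrnA mulr_natr.
Qed.

Lemma bernstein_weight_sum n : \sum_(j < n.+1) bernstein_weight n j = 1.
Proof.
have := @bernstein_weight_ffact n 0 isT; rewrite ffactn0 mulr1 L1 => <-.
by apply: eq_bigr => j _; rewrite ffactn0 mulr1.
Qed.

Lemma ratio_shift_approx (n k j : nat) : (j <= n)%N -> (k < n)%N ->
  `|j%:R / n%:R - (j - k)%:R / (n - k)%:R| <= k%:R / (n - k)%:R :> R.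
Proof.
move=> jn kn; have n0 : 0 < n%:R :> R by rewrite ltr0n (leq_ltn_trans _ kn).
have nk0 : 0 < (n - k)%:R :> R by rewrite ltr0n subn_gt0.
(* For [j <= k] the truncated difference makes the second ratio 0. *)
have [jk|kj] := leqP j k.
  rewrite (eqP jk) mul0r subr0 ger0_norm ?divr_ge0 ?ler0n//.
  rewrite ler_pM ?invr_ge0 ?ler0n ?ler_nat//.
  by rewrite lef_pV2 ?posrE// ler_nat leq_subr.
have -> : j%:R / n%:R - (j - k)%:R / (n - k)%:R =
    k%:R / (n - k)%:R * ((n - j)%:R / n%:R) :> R.
  rewrite !natrB ?(ltnW kj)// ?(ltnW kn)//; field.
  by rewrite -natrB ?(ltnW kn)// !gt_eqF.
rewrite ger0_norm ?mulr_ge0 ?invr_ge0 ?ler0n//.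
by rewrite ler_piMr ?divr_ge0 ?ler0n// ler_pdivrMr// mul1r ler_nat leq_subr.
Qed.

(** The quotient of falling factorials is a product of [k] ratios (j - i) / (n - i), each within k /
    (n - k) of j / n. *)
Lemma ffact_ratio_approx n k j : (j <= n)%N -> (k < n)%N ->
  `|(j%:R / n%:R) ^+ k - (j ^_ k)%:R / (n ^_ k)%:R| <= (k * k)%:R / (n - k)%:R :> R.
Proof.
(* The quotient is also kept between 0 and 1, so that the errors of the successive factors simply
   add up. *)
move=> jn kn; have : 0 <= ((j ^_ k)%:R / (n ^_ k)%:R : R) <= 1 /\
  `|(j%:R / n%:R) ^+ k - (j ^_ k)%:R / (n ^_ k)%:R : R| <= (k * k)%:R / (n - k)%:R;
  last by case.
elim: k kn => [|k IHk] kn.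
  by rewrite !ffactn0 expr0 divr1 subrr normr0 mul0n mul0r lexx ler01.
have k'n : (k < n)%N by exact: ltnW.
have n0 : 0 < n%:R :> R by rewrite ltr0n (leq_ltn_trans _ kn).
have nk0 : 0 < (n - k)%:R :> R by rewrite ltr0n subn_gt0.
have [/andP[b0 b1] abk] := IHk k'n.
rewrite !ffactnSr !natrM invfM mulrACA exprS.
set a := j%:R / n%:R in abk *; set b := _ / (n ^_ k)%:R in b0 b1 abk *.
set c := _ / (n - k)%:R.
have /andP[a0 a1] : 0 <= a <= 1.
  by rewrite divr_ge0 ?ler0n//= ler_pdivrMr// mul1r ler_nat.
have /andP[c0 c1] : 0 <= c <= 1.
  by rewrite divr_ge0 ?ler0n//= ler_pdivrMr// mul1r ler_nat leq_sub2r.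
split; first by rewrite mulr_ge0//= mulr_ile1.
have -> : a * a ^+ k - b * c = a * (a ^+ k - b) + b * (a - c) by ring.
apply: (@le_trans _ _ ((k * k)%:R / (n - k)%:R + k%:R / (n - k)%:R)).
  rewrite (le_trans (ler_normD _ _))// lerD// normrM ger0_norm//.
    by rewrite (le_trans _ abk)// ler_piMl.
  by rewrite (le_trans _ (ratio_shift_approx jn k'n))// ler_piMl.
rewrite -mulrDl -natrM -natrD ler_pM ?invr_ge0 ?ler0n//.
  by rewrite ler_nat -mulnSr leq_mul.
by rewrite lef_pV2 ?posrE ?ltr0n ?subn_gt0// ler_nat leq_sub2l.
Qed.

(** Factorial moments are exact for these weights and the total mass is 1, so the error is only that
    of replacing factorial powers by powers. *)
Lemma bernstein_weight_moment n k : (k < n)%N ->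
  `|\sum_(j < n.+1) bernstein_weight n j * (j%:R / n%:R) ^+ k - L 'X^k| <=
  (k * k)%:R / (n - k)%:R.
Proof.
move=> kn; have f0 : (n ^_ k)%:R != 0 :> R.
  by rewrite pnatr_eq0 -lt0n ffact_gt0 ltnW.
have -> : L 'X^k =
    \sum_(j < n.+1) bernstein_weight n j * ((j ^_ k)%:R / (n ^_ k)%:R).
  under eq_bigr do rewrite mulrA; rewrite -mulr_suml.
  by rewrite bernstein_weight_ffact ?mulfK// ltnW.
rewrite -sumrB (le_trans (ler_norm_sum _ _ _))//.
have cE : (k * k)%:R / (n - k)%:R = \sum_(j < n.+1) bernstein_weight n j *
    ((k * k)%:R / (n - k)%:R).
  by rewrite -mulr_suml bernstein_weight_sum mul1r.
rewrite [leRHS]cE; apply: ler_sum => j _.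
rewrite -mulrBr normrM (ger0_norm (bernstein_weight_ge0 _ _)).
apply: ler_wpM2l; first exact: bernstein_weight_ge0.
by apply: ffact_ratio_approx => //; rewrite -ltnS.
Qed.

End BernsteinWeights.

(** * Quantile functions, Riemann sums and limits along an ultrafilter *)

Section DiscreteQuantile.
Variable R : realType.

(** The predicate [p] holds on an initial segment, whose length is the count, so the increments of
    [h] telescope. A function of a count thus becomes linear in indicators. *)
Lemma telescope_initial (n : nat) (p : nat -> bool) (h : nat -> R) :
  (forall j, p j.+1 -> p j) ->
  h (\sum_(j < n) p j)%N = h 0%N + \sum_(j < n) (p j)%:R * (h j.+1 - h j).
Proof.
move=> p_init; have p_le i j : (i <= j)%N -> p j -> p i.
  elim: j => [|j IHj]; first by rewrite leqn0 => /eqP ->.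
  by rewrite leq_eqVlt => /predU1P[->//|/IHj ij /p_init].
elim: n => [|n IHn]; first by rewrite !big_ord0 addr0.
rewrite !big_ord_recr /=; case pn : (p n); last by rewrite addn0 mul0r addr0.
have sumE : (\sum_(j < n) p j = n)%N.
  rewrite -[RHS]card_ord -sum1_card; apply: eq_bigr => j _.
  by rewrite (p_le _ n) // ltnW.
by rewrite addrA -IHn sumE mul1r addn1 addrC subrK.
Qed.

Lemma abel_sum (n : nat) (w h : nat -> R) :
  \sum_(j < n.+1) w j = 1 ->
  h 0%N + \sum_(j < n) (1 - \sum_(i < j.+1) w i) * (h j.+1 - h j) =
  \sum_(j < n.+1) w j * h j.
Proof.
move=> w1; suff abel m : h 0%N + \sum_(j < m)
    (1 - \sum_(i < j.+1) w i) * (h j.+1 - h j) =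
    \sum_(j < m) w j * h j + (1 - \sum_(i < m) w i) * h m.
  rewrite abel big_ord_recr/=; congr (_ + _ * _).
  by rewrite -w1 big_ord_recr/= addrAC subrr add0r.
elim: m => [|m IHm]; first by rewrite !big_ord0 subr0 mul1r addr0 add0r.
by rewrite !big_ord_recr /= addrA IHm; ring.
Qed.

End DiscreteQuantile.

Definition uniform01 (R : realType) : probability (measurableTypeR R) R :=
  uniform_prob (@ltr01 R).

Section UniformRiemannSums.
Variable R : realType.
Local Notation U := (uniform01 R).

Definition above (c u : R) : R := \1_(`]c, +oo[%classic) u.

Lemma aboveE c u : above c u = (c < u)%R%:R.
Proof.
rewrite /above indicE; congr (_%:R); congr nat_of_bool.
by apply/idP/idP; rewrite inE/= in_itv/= andbT.
Qed.

Lemma above_Linf c : above c \in Lfun U +oo%E.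
Proof. by apply: Linf_indic; exact: measurable_itv. Qed.

Lemma expectation_above c : 0 <= c <= 1 -> \int[U]_u above c u = 1 - c.
Proof.
move=> /andP[c0 c1].
transitivity (fine (\int[lebesgue_measure]_(x in `]c, +oo[)
    (uniform_pdf 0 1 x)%:E)%E).
  by apply: (@Rexpectation_indic _ _ R U); exact: measurable_itv.
rewrite integral_uniform_pdf.
have -> : `]c, +oo[ `&` `[0, 1] = `]c, 1]%classic :> set R.
  apply/seteqP; split => x /=; rewrite !in_itv/= ?andbT.
    by case=> -> /andP[_ ->].
  by move=> /andP[cx ->]; rewrite cx (le_trans c0 (ltW cx)).
rewrite (eq_integral (cst 1%:E)); last first.
  move=> x; rewrite inE/= in_itv/= => /andP[cx x1].
  by rewrite /uniform_pdf x1 (le_trans c0 (ltW cx)) subr0 invr1.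
rewrite integral_cst//= mul1e lebesgue_measure_itv/= lte_fin.
by case: ltgtP c1 => // -> _; rewrite subrr.
Qed.

Lemma ae_uniform01 : \forall u \ae U, (0 < u <= 1)%R.
Proof.
have UE c : 0 <= c <= 1 -> U `]c, +oo[%classic = (1 - c)%:E.
  move=> /expectation_above; rewrite Rexpectation_indic; last exact: measurable_itv.
  by move=> <-; rewrite fineK//; apply: fin_num_measure; exact: measurable_itv.
have N0 : U.-negligible (~` `]0, +oo[%classic).
  apply/negligibleP; first by apply: measurableC; exact: measurable_itv.
  apply: etrans (@probability_setC _ _ _ U _ (measurable_itv _)) _.
  apply: etrans (congr1 (fun z => 1 - z)%E (UE 0 _)) _.
    by rewrite lexx ler01.
  by rewrite subr0 subee.
have N1 : U.-negligible `]1, +oo[%classic.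
  apply/negligibleP; first exact: measurable_itv.
  by apply: etrans (UE 1 _) _; rewrite ?subrr// lexx ler01.
apply: negligibleS (negligibleU N0 N1) => u /= /negP.
rewrite negb_and -!leNgt -ltNge => /orP[u0|u1]; [left|right].
  by rewrite in_itv/= andbT; apply/negP; rewrite -leNgt.
by rewrite in_itv/= andbT.
Qed.

(** On the interval ]i / (m + 1), (i + 1) / (m + 1)], with indicator [p i], monotonicity puts [g]
    between its end values. The lower and upper sums differ by (g 1 - g 0) / (m + 1), whence a bound
    uniform in [g]. *)
Lemma riemann_sum_monotone (g : R -> R) (m : nat) :
  {homo g : x y / x <= y} -> (forall x, 0 <= g x <= 1) ->
  `|\int[U]_u g u - m.+1%:R^-1 * \sum_(i < m.+1) g (i%:R / m.+1%:R)|
    <= 1 / m.+1%:R.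
Proof.
move=> g_nd g01; have M0 : 0 < m.+1%:R :> R by rewrite ltr0n.
have gL : g \in Lfun U +oo%E.
  apply/LinfP; split; first exact: nondecreasing_measurable.
  by exists 1; apply: nearW => x; case/andP: (g01 x) => g0; rewrite ger0_norm.
pose h i := g (i%:R / m.+1%:R).
pose p i u : R := above (i%:R / m.+1%:R) u - above (i.+1%:R / m.+1%:R) u.
have pL i : p i \in Lfun U +oo%E by apply: LinfB; exact: above_Linf.
have Ep i : (i < m.+1)%N -> \int[U]_u p i u = m.+1%:R^-1.
  move=> im; have frac01 j : (j <= m.+1)%N -> 0 <= j%:R / m.+1%:R <= (1 : R).
    by move=> jm; rewrite divr_ge0 ?ler0n//= ler_pdivrMr// mul1r ler_nat.
  rewrite RexpectationB ?above_Linf// !expectation_above ?frac01// ?(ltnW im)//.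
  by rewrite -natr1; field; rewrite gt_eqF// -natr1 in M0 *.
have gpL i : (fun u => g u * p i u) \in Lfun U +oo%E by exact: LinfM.
have Eg : \int[U]_u g u = \sum_(i < m.+1) \int[U]_u (g u * p i u).
  rewrite -Rexpectation_sum//; apply: ae_eq_Rexpectation => //.
    exact: Linf_sum.
  apply: (@filterS _ _ (ae_filter_ringOfSetsType U) _ _ _ ae_uniform01) => u /andP[u0 u1].
  rewrite -mulr_sumr -(big_mkord xpredT (p ^~ u)).
  rewrite (telescope_sumr_eq (fun i : nat => - above (i%:R / m.+1%:R) u))//.
    by rewrite mul0r divff ?gt_eqF// !aboveE u0 ltNge u1 oppr0 opprK add0r mulr1.
  by move=> k _; rewrite opprK addrC.
have gp i : (i < m.+1)%N ->
    h i * m.+1%:R^-1 <= \int[U]_u (g u * p i u) <= h i.+1 * m.+1%:R^-1.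
  move=> im; have hh : h i <= h i.+1.
    by apply: g_nd; rewrite ler_pM2r ?invr_gt0// ler_nat.
  have bounds u : h i * p i u <= g u * p i u <= h i.+1 * p i u.
    rewrite /p !aboveE; have [iu|ui] := ltP (i.+1%:R / m.+1%:R) u.
      have -> : i%:R / m.+1%:R < u.
        by apply: le_lt_trans iu; rewrite ler_pM2r ?invr_gt0// ler_nat.
      by rewrite subrr !mulr0 lexx.
    case: ltP => [iu|_]; last by rewrite subrr !mulr0 lexx.
    by rewrite subr0 !mulr1 !g_nd// ltW.
  rewrite -!(Ep i im) -!RexpectationZ//; apply/andP; split;
    apply: ae_le_Rexpectation => //; try exact: LinfZ;
    by apply: nearW => u; case/andP: (bounds u).
have lo : m.+1%:R^-1 * \sum_(i < m.+1) h i <= \int[U]_u g u.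
  rewrite Eg mulr_sumr; apply: ler_sum => i _.
  by rewrite mulrC; case/andP: (gp i (ltn_ord i)).
have hi : \int[U]_u g u <= m.+1%:R^-1 * \sum_(i < m.+1) h i.+1.
  rewrite Eg mulr_sumr; apply: ler_sum => i _.
  by rewrite [leRHS]mulrC; case/andP: (gp i (ltn_ord i)).
rewrite ger0_norm ?subr_ge0// lerBlDr (le_trans hi)// -lerBlDr -mulrBr mulrC.
rewrite ler_pM2r ?invr_gt0// -sumrB -(big_mkord xpredT (fun i => h i.+1 - h i)).
rewrite telescope_sumr// lerBlDr (le_trans (andP (g01 _)).2)// lerDl.
by case/andP: (g01 (0%:R / m.+1%:R)).
Qed.

End UniformRiemannSums.

Section UltrafilterLimit.
Variable R : realType.

Lemma ultra_cvg01 (G : set_system nat) (x : nat -> R) : UltraFilter G ->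
  (forall n, 0 <= x n <= 1) -> exists l : R, x n @[n --> G] --> l.
Proof.
move=> UG x01; have PG : ProperFilter G by exact: ultra_proper.
pose F : set_system R := fmap x G.
have PF : ProperFilter F by exact: fmap_proper_filter.
have F01 : F (`[0, 1]%classic : set R).
  rewrite /F /fmap /=; apply: filterE => n /=; rewrite in_itv/=.
  exact: x01.
have [l [_ Fl]] := segment_compact PF F01.
exists l => V lV; have [//|GV] := in_ultra_setVsetC (x @^-1` V) UG.
have [y [/= yV]] := Fl (~` V) V GV lV.
by [].
Qed.

End UltrafilterLimit.

Section HausdorffMoments.
Variables (R : realType) (L : {poly R} -> R).
Hypothesis L_scalar : scalar L.
Hypothesis L1 : L 1 = 1.
Hypothesis L_ge0 : forall j l, 0 <= L ('X^j * (1 - 'X) ^+ l).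
Local Notation U := (uniform01 R).
Local Notation w := (bernstein_weight L).

Let w_ge0 n j : 0 <= w n j. Proof. exact: bernstein_weight_ge0. Qed.
Let w_sum n : \sum_(j < n.+1) w n j = 1.
Proof. exact: bernstein_weight_sum. Qed.

Let cdf n j := \sum_(i < j.+1) w n i.

Let cdf01 n j : (j <= n)%N -> 0 <= cdf n j <= 1.
Proof.
move=> jn; rewrite sumr_ge0//= -(w_sum n) /cdf.
rewrite -!(big_mkord xpredT (w n)) [leRHS](big_cat_nat (n := j.+1))//=.
by rewrite lerDl sumr_ge0.
Qed.

(* The quantile function of the measure with mass [w n j] at [j / n]. *)
Let quantile n u : R := (\sum_(j < n) (cdf n j < u)%R)%:R / n%:R.

Let quantile01 n u : 0 <= quantile n u <= 1.
Proof.
rewrite divr_ge0 ?ler0n//=; case: n => [|n]; first by rewrite /quantile big_ord0 mul0r.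
rewrite ler_pdivrMr ?ltr0n// mul1r ler_nat -[leqRHS]card_ord -sum1_card.
by apply: leq_sum => j _; exact: leq_b1.
Qed.

Let quantile_nd n u v : u <= v -> quantile n u <= quantile n v.
Proof.
move=> uv; rewrite ler_wpM2r ?invr_ge0 ?ler0n// ler_nat; apply: leq_sum => j _.
by case: (ltP (cdf n j) u) => // /lt_le_trans -> .
Qed.

Let expectation_quantile n k : \int[U]_u (quantile n u ^+ k) =
  \sum_(j < n.+1) w n j * (j%:R / n%:R) ^+ k.
Proof.
pose h j : R := (j%:R / n%:R) ^+ k.
(* The quantile counts the thresholds [cdf n j] below [u], so its powers are sums of indicators;
   Abel summation then restores the masses. *)
have hE u : quantile n u ^+ k =
    h 0%N + \sum_(j < n) above (cdf n j) u * (h j.+1 - h j).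
  rewrite -[LHS]/(h _) (@telescope_initial R n (fun j => (cdf n j < u)%R) h) => [|j].
    by congr (_ + _); apply: eq_bigr => j _; rewrite aboveE.
  by apply: le_lt_trans; rewrite /cdf [leRHS]big_ord_recr/= lerDl.
have aL j : (fun u => above (cdf n j) u * (h j.+1 - h j)) \in Lfun U +oo%E.
  by apply: LinfM; [exact: above_Linf|exact: Linf_cst].
under eq_Rintegral do rewrite hE.
rewrite RexpectationD ?Linf_cst//; last by apply: Linf_sum => j; exact: aL.
rewrite Rexpectation_cst Rexpectation_sum => [|j]; last exact: aL.
rewrite -(abel_sum h (w_sum n)); congr (_ + _); apply: eq_bigr => j _.
under eq_Rintegral do rewrite mulrC.
rewrite RexpectationZ ?above_Linf// expectation_above 1?mulrC//.
by apply: cdf01; exact: ltnW.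
Qed.

(* [Q] is a limit, along an ultrafilter, of the quantile functions of the
   Bernstein measures; integrals of monotone functions pass to the limit because
   they are within [1 / m] of Riemann sums with [m] points. *)
Lemma hausdorff_moments : exists Q : R -> R,
  [/\ {homo Q : u v / u <= v}, forall u, 0 <= Q u <= 1 &
      forall k, \int[U]_u (Q u ^+ k) = L 'X^k].
Proof.
have [G [UG ooG]] := ultraFilterLemma (F := \oo) _.
have PG : ProperFilter G by exact: ultra_proper.
have [Q QE] := boolp.choice (fun u => ultra_cvg01 UG (fun n => quantile01 n u)).
have Q_nd : {homo Q : u v / u <= v}.
  move=> u v uv; apply: ler_cvg_to (QE u) (QE v) _.
  by apply: nearW => n; exact: quantile_nd.
have Q01 u : 0 <= Q u <= 1.
  apply/andP; split.
    apply: ler_cvg_to (cvg_cst 0) (QE u) _.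
    by apply: nearW => n; case/andP: (quantile01 n u).
  apply: ler_cvg_to (QE u) (cvg_cst (1 : R)) _.
  by apply: nearW => n; case/andP: (quantile01 n u).
exists Q; split => // k; apply/eqP; rewrite -subr_eq0; apply/eqP.
apply: (@le_divn_eq0 _ _ (1 + 1)) => m.
have riemann (f : R -> R) : {homo f : u v / u <= v} -> (forall u, 0 <= f u <= 1) ->
    `|\int[U]_u (f u ^+ k) -
      m.+1%:R^-1 * \sum_(i < m.+1) f (i%:R / m.+1%:R) ^+ k| <= 1 / m.+1%:R.
  move=> f_nd f01; apply: (riemann_sum_monotone (g := fun u => f u ^+ k)).
    by move=> u v uv; rewrite lerXn2r ?nnegrE ?f_nd//; case/andP: (f01 u);
      case/andP: (f01 v).
  by move=> u; case/andP: (f01 u) => f0 f1; rewrite exprn_ge0// exprn_ile1.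
pose S (f : R -> R) := m.+1%:R^-1 * \sum_(i < m.+1) f (i%:R / m.+1%:R) ^+ k.
have SQ : S (quantile n) @[n --> G] --> S Q.
  apply: cvgMr; apply: cvg_big => [|i _]; first exact: add_continuous.
  exact: (cvg_comp _ _ (QE _) (@exprn_continuous R k _)).
have IQ : \int[U]_u (quantile n u ^+ k) @[n --> G] --> L 'X^k.
  have : \int[U]_u (quantile n u ^+ k) @[n --> \oo] --> L 'X^k.
    apply/cvgrPdist_le => e e0.
    near=> n; have kn : (k < n)%N by near: n; exact: nbhs_infty_gt.
    rewrite distrC expectation_quantile.
    rewrite (le_trans (bernstein_weight_moment L_scalar L1 L_ge0 kn))//.
    have nk : (Num.truncn ((k * k)%:R / e) < n - k)%N.
      by rewrite ltn_subRL; near: n; exact: nbhs_infty_gt.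
    rewrite ler_pdivrMr ?ltr0n ?subn_gt0// mulrC -ler_pdivrMr//.
    by rewrite (le_trans (ltW (truncnS_gt _)))// ler_nat.
  by apply: cvg_trans; exact: cvg_app.
have SL : `|S Q - L 'X^k| <= 1 / m.+1%:R.
  apply: ler_cvg_to (cvg_norm (cvgB SQ IQ)) (cvg_cst _) _.
  apply: nearW => n /=; rewrite distrC; apply: riemann => [u v|u].
    exact: quantile_nd.
  exact: quantile01.
have -> : \int[U]_u (Q u ^+ k) - L 'X^k =
    (\int[U]_u (Q u ^+ k) - S Q) + (S Q - L 'X^k) by ring.
by rewrite (le_trans (ler_normD _ _))// mulrDl lerD//; exact: riemann.
Unshelve. all: by end_near. Qed.

End HausdorffMoments.

(** * Laws of bounded self-adjoint elements *)

Section DistributionMoments.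
Context d (T : measurableType d) (R : realType) (P : probability T R).

Lemma RV_exists (f : T -> R) : measurable_fun setT f ->
  exists F : {RV P >-> R}, F = f :> (T -> R).
Proof.
move=> mf; pose F : {mfun T >-> R} := HB.pack_for {mfun T >-> R} f
  (@isMeasurableFun.Build _ _ T R f mf).
by exists F.
Qed.

Variable X : {RV P >-> R}.
Hypothesis X_bounded : (X : T -> R) \in Lfun P +oo%E.

Lemma moment_distribution k : moment (distribution P X) k = \int[P]_t (X t ^+ k).
Proof.
rewrite /moment /Rintegral; congr fine.
rewrite integral_distribution//=.
  by apply/measurable_EFinP; exact: measurable_funX.
exact: (Linf_integrable (LinfX k X_bounded)).
Qed.

Lemma distribution_compact_support : compactly_supported (distribution P X).
Proof.
have [mX [M XM]] := (LinfP P X).1 X_bounded.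
exists `[- M, M]%classic; first exact: segment_compact.
have mB : measurable (~` `[- M, M]%classic : set R).
  by apply: measurableC; exact: measurable_itv.
have mXB : measurable ((X : T -> R) @^-1` ~` `[- M, M]%classic).
  by rewrite -[_ @^-1` _]setTI; exact: mX.
suff : P ((X : T -> R) @^-1` ~` `[- M, M]%classic) = 0%E by [].
apply/(negligibleP _ mXB); apply: negligibleS XM => t /=; rewrite in_itv/=.
by rewrite ler_norml.
Qed.

End DistributionMoments.

Section SpectralLaw.
Variables (R : realType).
Local Notation C := R[i].
Variables (A : algType C) (st : A -> A) (phi : ncstate A) (a : A) (K : R).
Hypothesis stP : is_star st.
Hypothesis phi_ge0 : positive_state st phi.
Hypothesis sta : st a = a.
Hypothesis K0 : 0 < K.
Hypothesis a_lower : forall p, 0 <= phi (st p * ((K%:C)%:A + a) * p).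
Hypothesis a_upper : forall p, 0 <= phi (st p * ((K%:C)%:A - a) * p).

(* [c] rescales [a] so that 0 <= c <= 1. *)
Let c : A := ((2 * K)^-1)%:C *: ((K%:C)%:A + a).
Let h (p : {poly R}) : A := horner_alg c (map_poly (real_complex R) p).

Let hD p q : h (p + q) = h p + h q.
Proof. by rewrite /h !rmorphD. Qed.

Let h0 : h 0 = 0.
Proof. by rewrite /h !rmorph0. Qed.

Let hM p q : h (p * q) = h p * h q.
Proof. by rewrite /h !rmorphM. Qed.

Let h1 : h 1 = 1.
Proof. by rewrite /h !rmorph1. Qed.

Let hX : h 'X = c.
Proof. by rewrite /h map_polyX horner_algX. Qed.

Let hC x : h x%:P = (x%:C)%:A.
Proof. by rewrite /h map_polyC /= horner_algC. Qed.

Let hZ x p : h (x *: p) = x%:C *: h p.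
Proof. by rewrite -mul_polyC hM hC mulr_algl. Qed.

Let twoK0 : 2 * K != 0. Proof. by rewrite mulf_neq0 ?pnatr_eq0// gt_eqF. Qed.

Let cK : (K%:C)%:A + a = (2 * K)%:C *: c.
Proof. by rewrite /c scalerA -rmorphM divff// scale1r. Qed.

Let stc : st c = c.
Proof.
case: stP => _ stD stZ _; rewrite /c stZ stD stZ (star_one stP) sta.
by congr (_ *: (_ *: _ + _)); exact: conjc_real.
Qed.

Let sth p : st (h p) = h p.
Proof.
case: stP => _ stD stZ stM; elim/poly_ind : p => [|p x IHp].
  by rewrite h0 -[X in st X](scale0r 0) stZ rmorph0 scale0r.
rewrite hD hM hX hC stD stM IHp stc stZ (star_one stP) -{1}hX -hM mulrC hM hX.
by congr (_ + _ *: _); exact: conjc_real.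
Qed.

Let onec : 1 - c = ((2 * K)^-1)%:C *: ((K%:C)%:A - a).
Proof.
apply/eqP; rewrite subr_eq /c -scalerDr addrACA addNr addr0 -scalerDl.
have KK : (2 * K)^-1 * (K + K) = 1.
  by rewrite (_ : K + K = 2 * K) ?mulVf//; ring.
by rewrite scalerA -rmorphD -rmorphM KK scale1r.
Qed.

Let h_ge0_X q : 0 <= phi (h (q * 'X * q)).
Proof.
rewrite !hM hX -{1}sth /c -scalerAr -scalerAl linearZ mulr_ge0 ?a_lower//.
by rewrite ler0c invr_ge0 mulr_ge0 ?ler0n// ltW.
Qed.

Let h_ge0_1X q : 0 <= phi (h (q * (1 - 'X) * q)).
Proof.
have -> : h (q * (1 - 'X) * q) = st (h q) * (1 - c) * h q.
  rewrite !hM sth; congr (_ * _ * _).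
  by rewrite -polyC1 -mulN1r -polyC1 -polyCN hD hM !hC hX rmorphN !scale1r
    rmorph1 scaleN1r mulN1r.
rewrite onec -scalerAr -scalerAl linearZ mulr_ge0 ?a_upper//.
by rewrite ler0c invr_ge0 mulr_ge0 ?ler0n// ltW.
Qed.

Let h_ge0_sqr q : 0 <= phi (h (q * q)).
Proof. by rewrite hM -{1}sth; exact: phi_ge0. Qed.

Let phiD x y : phi (x + y) = phi x + phi y.
Proof. by rewrite linearD. Qed.

(* For odd exponents, [x (1 - x) = (1 - x) x (1 - x) + x (1 - x) x]. *)
Lemma functional_calculus_ge0 j l : 0 <= phi (h ('X^j * (1 - 'X) ^+ l)).
Proof.
rewrite -[j]odd_double_half -[l]odd_double_half -!addnn !exprD.
set x := 'X; set y := 1 - 'X; set q := x ^+ j./2 * y ^+ l./2.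
have xy : x + y = 1 by rewrite /x /y addrC subrK.
case: (odd j); case: (odd l); rewrite /= ?expr0 ?expr1.
- have -> : x * (x ^+ j./2 * x ^+ j./2) * (y * (y ^+ l./2 * y ^+ l./2)) =
      (y * q) * x * (y * q) + (x * q) * y * (x * q).
    transitivity ((x + y) * (x * y * q * q)); last by rewrite /q; ring.
    by rewrite xy mul1r /q; ring.
  by rewrite hD phiD addr_ge0.
- by rewrite (_ : _ * _ = q * x * q)//; rewrite /q; ring.
- by rewrite (_ : _ * _ = q * y * q)//; rewrite /q; ring.
- by rewrite (_ : _ * _ = q * q)//; rewrite /q; ring.
Qed.

Let L p := complex.Re (phi (h p)).

Let L_scalar : scalar L.
Proof.
move=> x p q; rewrite /L hD hZ phiD linearZ /=.
by case: (phi (h p)) (phi (h q)) => [? ?] [? ?] /=; rewrite mul0r subr0.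
Qed.

Let phi_h p : phi (h p) = (L p)%:C.
Proof.
(* Values at monomials are nonnegative, hence real; the extra power of X carries the induction on
   the polynomial. *)
suff Im0 k : complex.Im (phi (h (p * 'X^k))) = 0.
  rewrite /L [LHS]complexE; have := Im0 0%N; rewrite expr0 mulr1 => ->.
  by rewrite mulr0 addr0.
elim/poly_ind : p k => [|p x IHp] k.
  by rewrite mul0r h0 linear0.
rewrite mulrDl -mulrA -exprS hD phiD mul_polyC hZ linearZ /=.
have := IHp k.+1; case: (phi (h (p * 'X^(k.+1)))) => u v /= ->.
have /ger0_Im := functional_calculus_ge0 k 0; rewrite expr0 mulr1.
by case: (phi (h ('X^k))) => u' v' /= ->; rewrite mulr0 mul0r !addr0.
Qed.

(** The functional [L], evaluation at [c] followed by the state, satisfies the hypotheses of the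
    moment problem on [0, 1]. Rescaling the resulting variable gives one with the moments of [a]. *)
Lemma bounded_has_law : exists rho : probability R R, has_law phi a rho.
Proof.
have L1 : L 1 = 1 by rewrite /L h1 ncstate1.
have L_ge0 j l : 0 <= L ('X^j * (1 - 'X) ^+ l).
  by rewrite -ler0c -phi_h functional_calculus_ge0.
have [Q [Q_nd Q01 QL]] := hausdorff_moments L_scalar L1 L_ge0.
(* This inverts the rescaling, as a = 2 K c - K. *)
pose f u := 2 * K * Q u - K.
have QLinf : Q \in Lfun (uniform01 R) +oo%E.
  apply/LinfP; split; first exact: nondecreasing_measurable.
  by exists 1; apply: nearW => u; case/andP: (Q01 u) => q0; rewrite ger0_norm.
have fL : f \in Lfun (uniform01 R) +oo%E.
  by apply: LinfB; [exact: LinfZ|exact: Linf_cst].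
have [F FE] := RV_exists (uniform01 R) (Linf_measurable fL).
have FL : (F : measurableTypeR R -> R) \in Lfun (uniform01 R) +oo%E.
  by rewrite FE.
have LQ p : L p = \int[uniform01 R]_u p.[Q u].
  suff LQX k : L (p * 'X^k) = \int[uniform01 R]_u (p.[Q u] * Q u ^+ k).
    by have := LQX 0%N; rewrite expr0 mulr1; under eq_Rintegral do rewrite mulr1.
  have pQ (q : {poly R}) : (fun u => q.[Q u]) \in Lfun (uniform01 R) +oo%E.
    elim/poly_ind : q => [|q x qL].
      by under eq_fun do rewrite horner0; exact: Linf_cst.
    under eq_fun do rewrite hornerMXaddC.
    by apply: LinfD; [exact: LinfM|exact: Linf_cst].
  have QX i : (fun u => Q u ^+ i) \in Lfun (uniform01 R) +oo%E by exact: LinfX.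
  elim/poly_ind : p k => [|p x IHp] k.
    under eq_Rintegral do rewrite horner0 mul0r.
    by rewrite Rexpectation_cst mul0r /L h0 linear0.
  rewrite mulrDl -mulrA -exprS mul_polyC addrC L_scalar IHp -QL.
  rewrite -RexpectationZ// -RexpectationD//; [|exact: LinfZ|exact: LinfM].
  by apply: eq_Rintegral => u _; rewrite hornerMXaddC exprS; ring.
exists (distribution (uniform01 R) F); split.
  exact: distribution_compact_support.
move=> k; rewrite moment_distribution// FE.
have -> : a ^+ k = h (((2 * K) *: 'X - K%:P) ^+ k).
  have -> : a = h ((2 * K) *: 'X - K%:P).
    by rewrite -polyCN hD hZ hX hC -cK rmorphN scaleNr addrAC subrr add0r.
  by elim: k => [|k IHk]; rewrite ?expr0 ?h1// !exprS hM IHk.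
rewrite phi_h LQ; congr (_%:C); apply: eq_Rintegral => u _.
by rewrite !hornerE.
Qed.

End SpectralLaw.

(** * Free convolutions *)

Section FreeLaws.
Variable R : realType.
Local Notation C := R[i].

Lemma free_elements_generated (I : choiceType) (A : algType C) (phi : A -> C)
    (x y : I -> A) : free_elements phi x ->
  (forall i, generated_subalgebra [set x i] (y i)) -> free_elements phi y.
Proof.
move=> x_free xy s s2 s_alt sP; apply: x_free => // z /sP[yz phi_z].
split=> // S [S_closed xS]; apply: yz; split => // _ ->.
by apply: xy; split.
Qed.

Lemma expr_cyclic (A : nzRingType) (x y : A) k :
  (x * y) ^+ k.+1 = x * (y * x) ^+ k * y.
Proof.
elim: k => [|k IHk]; first by rewrite expr0 mulr1.
by rewrite exprS IHk [in RHS]exprS !mulrA.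
Qed.

(** Turns the moments of s b s into mixed moments of s^2 and b, to which [free_joint_law]
    applies. *)
Lemma tracial_sandwich (A : algType C) (phi : ncstate A) (s b : A) k :
  tracial phi -> phi ((s * b * s) ^+ k) = phi ((s * s * b) ^+ k).
Proof.
move=> phiC; case: k => [|k]; first by rewrite !expr0.
by rewrite expr_cyclic phiC !mulrA -exprS.
Qed.

Lemma nceval_addX (I : choiceType) (A : algType C) (a : I -> A) i j k :
  nceval a ((ncX C i + ncX C j) ^+ k) = (a i + a j) ^+ k.
Proof. by rewrite rmorphXn rmorphD /= !ncevalX. Qed.

Lemma nceval_mulX (I : choiceType) (A : algType C) (a : I -> A) i j k :
  nceval a ((ncX C i * ncX C j) ^+ k) = (a i * a j) ^+ k.
Proof. by rewrite rmorphXn rmorphM /= !ncevalX. Qed.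

Section Uniqueness.
Variables (A : algType C) (phi : ncstate A) (a b : A).
Variables (mu nu rho : probability R R).
Hypothesis ab_free : free_elements phi (pair_family a b).
Hypothesis a_law : forall k, phi (a ^+ k) = (moment mu k)%:C.
Hypothesis b_law : forall k, phi (b ^+ k) = (moment nu k)%:C.

(** [rho] may come from any realization, so the conclusion holds for whichever measure [xget]
    selects. *)
Lemma free_add_law_moment k : free_add_law mu nu rho ->
  phi ((a + b) ^+ k) = (moment rho k)%:C.
Proof.
move=> [B [st [psi [a' [b' [_ _ _ ab'_free
  [[_ a'_law] [_ b'_law] [_ <-]]]]]]]].
have ab i j : phi (pair_family a b i ^+ j) = psi (pair_family a' b' i ^+ j).
  by case: i; rewrite /= ?a_law ?b_law ?a'_law ?b'_law.
have := free_joint_law ab_free ab'_free ab ((ncX C true + ncX C false) ^+ k).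
by rewrite /joint_law !nceval_addX.
Qed.

Lemma free_mul_law_moment k : free_mul_law mu nu rho ->
  phi ((a * b) ^+ k) = (moment rho k)%:C.
Proof.
move=> [B [st [psi [a' [b' [s [_ [_ psiC] [_ [_ a'E]] ab'_free
  [[_ a'_law] [_ b'_law] [_ <-]]]]]]]]].
have ab i j : phi (pair_family a b i ^+ j) = psi (pair_family a' b' i ^+ j).
  by case: i; rewrite /= ?a_law ?b_law ?a'_law ?b'_law.
have := free_joint_law ab_free ab'_free ab ((ncX C true * ncX C false) ^+ k).
by rewrite /joint_law !nceval_mulX /= tracial_sandwich// a'E.
Qed.

End Uniqueness.

Lemma mulr_sqr_sqr (A : nzRingType) (c : A) : c * c * (c * c) = c ^+ 4.
Proof. by rewrite -!expr2 -exprM. Qed.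

Section Positivity.
Variables (A : algType C) (st : A -> A) (phi : ncstate A).
Hypothesis stP : is_star st.

Lemma star_sandwich s b : st s = s -> st b = b -> st (s * b * s) = s * b * s.
Proof. by case: stP => _ _ _ stM ss bb; rewrite 2!stM ss bb mulrA. Qed.

Lemma star_sqr c : st c = c -> st (c * c) = c * c.
Proof. by case: stP => _ _ _ stM cc; rewrite stM cc. Qed.

Lemma star_add a b : st a = a -> st b = b -> st (a + b) = a + b.
Proof. by case: stP => _ stD _ _ aa bb; rewrite stD aa bb. Qed.

Lemma positive_state_unit (y : A) :
  (forall p, 0 <= phi (st p * ((1%:C)%:A + 0%:C *: y) * p)) ->
  positive_state st phi.
Proof.
by move=> h p; have := h p; rewrite scale1r scale0r addr0 mulr1.
Qed.

Lemma positive_add (a b x y p : A) :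
  0 <= phi (st p * (x + a) * p) -> 0 <= phi (st p * (y + b) * p) ->
  0 <= phi (st p * (x + y + (a + b)) * p).
Proof.
by move=> ha hb; rewrite addrACA mulrDr mulrDl linearD addr_ge0.
Qed.

(** With t = s^2, K L + s b s = K (L - t) + s (K + b) s, and the last term is moved onto the vector
    s p because s is self-adjoint. *)
Lemma positive_sandwich (s t b p : A) (K L : R) : 0 <= K -> st s = s ->
  s * s = t -> (forall q, 0 <= phi (st q * ((L%:C)%:A - t) * q)) ->
  (forall q, 0 <= phi (st q * ((K%:C)%:A + b) * q)) ->
  0 <= phi (st p * (((K * L)%:C)%:A + s * b * s) * p).
Proof.
case: stP => _ _ _ stM K0 sts <- ha hb.
have -> : st p * (((K * L)%:C)%:A + s * b * s) * p =
    K%:C *: (st p * ((L%:C)%:A - s * s) * p) +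
    st (s * p) * ((K%:C)%:A + b) * (s * p).
  rewrite stM sts scalerAl scalerAr scalerBr scalerA -rmorphM.
  rewrite -!mulrA (mulrA _ s p) !mulrA -[in RHS]mulrDl -!mulrA -[in RHS]mulrDr.
  rewrite !mulrA; congr (_ * _ * _); rewrite mulrDr mulrDl.
  by rewrite -scalerAr -scalerAl mulr1 addrA subrK.
by rewrite linearD linearZ addr_ge0// mulr_ge0// ler0c.
Qed.

Lemma positive_sandwichN (s t b p : A) (K L : R) : 0 <= K -> st s = s ->
  s * s = t -> (forall q, 0 <= phi (st q * ((L%:C)%:A - t) * q)) ->
  (forall q, 0 <= phi (st q * ((K%:C)%:A - b) * q)) ->
  0 <= phi (st p * (((K * L)%:C)%:A - s * b * s) * p).
Proof.
move=> K0 sts sst ha hb; have := positive_sandwich p K0 sts sst ha hb.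
by rewrite mulrN mulNr.
Qed.

End Positivity.

End FreeLaws.

Section SameLaw.
Context d0 (T0 : measurableType d0) d (T : measurableType d) (R : realType).
Variables (P0 : probability T0 R) (P : probability T R).

Lemma same_law_moment (G : T0 -> R) (F : T -> R) k :
  G \in Lfun P0 +oo%E -> F \in Lfun P +oo%E ->
  (forall B : set R, measurable B -> P (F @^-1` B) = P0 (G @^-1` B)) ->
  \int[P]_t (F t ^+ k) = \int[P0]_t (G t ^+ k).
Proof.
move=> GL FL FG; have [F' F'E] := RV_exists P (Linf_measurable FL).
have [G' G'E] := RV_exists P0 (Linf_measurable GL).
have := @moment_distribution _ _ _ _ F' _ k; rewrite F'E => /(_ FL) <-.
have := @moment_distribution _ _ _ _ G' _ k; rewrite G'E => /(_ GL) <-.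
rewrite /moment /Rintegral; congr fine; apply: eq_measure_integral => B mB _.
by have := FG _ mB; rewrite -F'E -G'E.
Qed.

Lemma same_law_ae (G : T0 -> R) (F : T -> R) (B : set R) :
  measurable_fun setT G -> measurable_fun setT F -> measurable B ->
  (forall B : set R, measurable B -> P (F @^-1` B) = P0 (G @^-1` B)) ->
  (\forall t \ae P0, B (G t)) <-> (\forall t \ae P, B (F t)).
Proof.
move=> mG mF mB FG; have mB' : measurable (~` B) by exact: measurableC.
have mGB : measurable (G @^-1` (~` B)) by rewrite -[_ @^-1` _]setTI; exact: mG.
have mFB : measurable (F @^-1` (~` B)) by rewrite -[_ @^-1` _]setTI; exact: mF.
have := FG _ mB'; split.
- move=> /(negligibleP _ mGB) GB; apply/(negligibleP _ mFB).
  by apply: etrans (FG _ mB') _.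
- move=> /(negligibleP _ mFB) FB; apply/(negligibleP _ mGB).
  by apply: etrans (esym (FG _ mB')) _.
Qed.

End SameLaw.

Section LimitLaws.
Context d (T : measurableType d) (R : realType) (P : probability T R).
Local Notation C := R[i].
Variables (U V : nat -> T -> R) (mu nu : probability R R) (M : R).
Variable H : forall n, 'M[C]_n.+1.
Hypothesis UL : forall i, U i \in Lfun P +oo%E.
Hypothesis VL : forall i, V i \in Lfun P +oo%E.
Hypothesis M0 : 0 < M.
Hypothesis U_bounded : forall i, \forall t \ae P, `|U i t| <= M.
Hypothesis V_bounded : forall i, \forall t \ae P, `|V i t| <= M.
Hypothesis H_hadamard : forall n, complex_hadamard (H n).
Variable tau : ncstate (ncpoly C bool).
Hypothesis tauP : forall f,
  (joint_law (rmx_state P n) (diag_model H UL VL n) f : C^o)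
    @[n --> \oo] --> (tau f : C^o).

Local Notation pos := (limit_positive U_bounded V_bounded H_hadamard (@tauP)).

Lemma limit_positive_state : positive_state (@ncstar C bool) tau.
Proof.
apply: (positive_state_unit (y := ncX C true ^+ 0)) => p.
by apply: pos => w _; rewrite mul0r addr0.
Qed.

Lemma limit_lower b p : 0 <= tau (ncstar p * ((M%:C)%:A + ncX C b) * p).
Proof.
have -> : (M%:C)%:A + ncX C b = (M%:C)%:A + 1%:C *: ncX C b ^+ 1.
  by rewrite scale1r expr1.
apply: pos => w; rewrite ler_norml mul1r expr1 => /andP[wM _].
by rewrite -lerBlDl sub0r.
Qed.

Lemma limit_upper b p : 0 <= tau (ncstar p * ((M%:C)%:A - ncX C b) * p).
Proof.
have -> : (M%:C)%:A - ncX C b = (M%:C)%:A + (-1)%:C *: ncX C b ^+ 1.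
  by rewrite rmorphN scaleN1r expr1.
apply: pos => w; rewrite ler_norml mulN1r expr1 => /andP[_ wM].
by rewrite subr_ge0.
Qed.

Lemma limit_upper_X4 b p :
  0 <= tau (ncstar p * (((M ^+ 4)%:C)%:A - ncX C b ^+ 4) * p).
Proof.
have -> : ((M ^+ 4)%:C)%:A - ncX C b ^+ 4 =
    ((M ^+ 4)%:C)%:A + (-1)%:C *: ncX C b ^+ 4.
  by rewrite rmorphN scaleN1r.
apply: pos => w wM; rewrite mulN1r subr_ge0 -[w ^+ 4]ger0_norm ?exprn_even_ge0//.
by rewrite normrX lerXn2r// nnegrE ltW.
Qed.

Lemma limit_free_add_law :
  free_elements tau (@ncX C bool) ->
  has_law tau (ncX C true) mu -> has_law tau (ncX C false) nu ->
  exists rho, free_add_law mu nu rho.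
Proof.
move=> tau_free mu_law nu_law; have stP := ncstarP R bool.
have st_sum : ncstar (ncX C true + ncX C false) = ncX C true + ncX C false.
  by apply: star_add => //; exact: ncstarX.
have twoM : ((M + M)%:C)%:A = (M%:C)%:A + (M%:C)%:A :> ncpoly C bool.
  by rewrite rmorphD scalerDl.
have [|p|p|rho rho_law] := @bounded_has_law _ _ _ tau _ (M + M) stP
  limit_positive_state st_sum.
- by rewrite addr_gt0.
- by rewrite twoM; apply: positive_add; exact: limit_lower.
- rewrite twoM opprD; apply: positive_add; exact: limit_upper.
exists rho, (ncpoly C bool), (@ncstar C bool), tau, (ncX C true), (ncX C false).
split=> //; [exact: limit_positive_state|split; exact: ncstarX|].
by have -> : pair_family (ncX C true) (ncX C false) = @ncX C bool
  by apply/funext => -[].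
Qed.

Lemma limit_free_mul_law :
  free_elements tau (@ncX C bool) ->
  let s := ncX C true * ncX C true in
  has_law tau (s * s) mu -> has_law tau (ncX C false) nu ->
  exists rho, [/\ free_mul_law mu nu rho,
    free_elements tau (pair_family (s * s) (ncX C false)) &
    tracial tau].
Proof.
move=> tau_free s mu_law nu_law; have stP := ncstarP R bool.
have sts : ncstar s = s by apply: star_sqr => //; exact: ncstarX.
have st_sbs : ncstar (s * ncX C false * s) = s * ncX C false * s.
  by apply: star_sandwich => //; exact: ncstarX.
have ss4 : s * s = ncX C true ^+ 4 by exact: mulr_sqr_sqr.
have tauC : tracial tau by exact: limit_tracial (@tauP).
have s_free : free_elements tau (pair_family (s * s) (ncX C false)).
  apply: free_elements_generated tau_free _ => -[] /=.
    apply/generated_subalgebraP; exists 'X^4.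
    by rewrite rmorphXn /= horner_algX.
  by apply/generated_subalgebraP; exists 'X; rewrite horner_algX.
(* [M] bounds the second generator and [M ^+ 4] bounds s^2, the fourth power of the first one. *)
have [|p|p|rho rho_law] := @bounded_has_law _ _ _ tau _ (M * M ^+ 4) stP
  limit_positive_state st_sbs.
- exact: (mulr_gt0 M0 (exprn_gt0 4 M0)).
- exact: (positive_sandwich stP p (ltW M0) sts ss4
    (limit_upper_X4 true) (limit_lower false)).
- exact: (positive_sandwichN stP p (ltW M0) sts ss4
    (limit_upper_X4 true) (limit_upper false)).
exists rho; split; [|exact: s_free|exact: tauC].
exists (ncpoly C bool), (@ncstar C bool), tau, (s * s), (ncX C false), s.
split; [exact: stP| |split|exact: s_free|split].
- by split; [exact: limit_positive_state|exact: tauC].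
- exact: ncstarX.
- split; [exists (ncX C true)|exact: erefl].
  by apply: (congr1 (fun z => z * ncX C true)); exact/esym/ncstarX.
- exact: mu_law.
- exact: nu_law.
- exact: rho_law.
Qed.

End LimitLaws.

Lemma mulr_sqr_sqrX (A : nzRingType) (c : A) k :
  (c * c * (c * c)) ^+ k = c ^+ (4 * k).
Proof. by rewrite mulr_sqr_sqr exprM. Qed.

Lemma scaler_sandwich (K : comNzRingType) (A : algType K) (z : K) (s h y h' : A) :
  s * (z *: (h * y * h')) * s = z *: (s * h * y * h' * s).
Proof. by rewrite -scalerAr -scalerAl !mulrA. Qed.

Lemma rmorph_sandwich (A B : nzRingType) (f : {rmorphism A -> B}) (x y : A) k :
  f ((x * x * y * (x * x)) ^+ k) = (f x * f x * f y * (f x * f x)) ^+ k.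
Proof. by rewrite rmorphXn !rmorphM. Qed.

Lemma nceval_sandwich (R : realType) (I : choiceType) (A : algType R[i])
    (a : I -> A) i j k :
  nceval a ((ncX R[i] i * ncX R[i] i * ncX R[i] j *
    (ncX R[i] i * ncX R[i] i)) ^+ k) = (a i * a i * a j * (a i * a i)) ^+ k.
Proof. by apply: etrans (rmorph_sandwich _ _ _ _) _; rewrite /= !ncevalX. Qed.

(** * The matrix model for i.i.d. copies *)

Section Copies.
Context d0 (T0 : measurableType d0) d (T : measurableType d) (R : realType).
Variables (P0 : probability T0 R) (P : probability T R).
Local Notation C := R[i].
Variables (X Y : {RV P0 >-> R}) (Xs Ys : nat -> {RV P >-> R}).
Hypothesis X_bounded : (X : T0 -> R) \in Lfun P0 +oo%E.
Hypothesis Y_bounded : (Y : T0 -> R) \in Lfun P0 +oo%E.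
Hypothesis XY_copies : pair_copies P0 P X Y (fun i => Xs i) (fun i => Ys i).
Hypothesis XY_independent : pair_independent P (fun i => Xs i) (fun i => Ys i).

Lemma copies_law1 i (B : set R) : measurable B ->
  P (Xs i @^-1` B) = P0 (X @^-1` B).
Proof.
move=> mB; have := XY_copies i (measurableX mB (@measurableT _ R)).
have eB S (F G : S -> R) : rv_pair F G @^-1` (B `*` setT) = F @^-1` B.
  by apply/seteqP; split => t; [case|].
by rewrite !eB.
Qed.

Lemma copies_law2 i (B : set R) : measurable B ->
  P (Ys i @^-1` B) = P0 (Y @^-1` B).
Proof.
move=> mB; have := XY_copies i (measurableX (@measurableT _ R) mB).
have eB S (F G : S -> R) : rv_pair F G @^-1` (setT `*` B) = G @^-1` B.
  by apply/seteqP; split => t; [case|].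
by rewrite !eB.
Qed.

Lemma copies_bounded (G : T0 -> R) (F : nat -> T -> R) :
  G \in Lfun P0 +oo%E -> (forall i, measurable_fun setT (F i)) ->
  (forall i (B : set R), measurable B -> P (F i @^-1` B) = P0 (G @^-1` B)) ->
  exists M, forall K, M <= K -> forall i, \forall t \ae P, `|F i t| <= K.
Proof.
move=> /LinfP[mG [M GM]] mF FG; exists M => K MK i.
have : \forall t \ae P, `[- K, K]%classic (F i t).
  have mK : measurable (`[- K, K]%classic : set R) by [].
  apply/(same_law_ae mG (mF i) mK (FG i)).
  apply: filterS GM => t GtM; rewrite /= in_itv /= -ler_norml.
  exact: le_trans GtM MK.
by apply: filterS => t; rewrite /= in_itv /= -ler_norml.
Qed.

Variable g : R -> R.
Hypothesis g_measurable : measurable_fun setT g.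
Hypothesis gX_bounded : g \o X \in Lfun P0 +oo%E.

Lemma copies_law1_comp i (B : set R) : measurable B ->
  P ((g \o Xs i) @^-1` B) = P0 ((g \o X) @^-1` B).
Proof.
move=> mB; have mgB : measurable (g @^-1` B).
  by rewrite -[_ @^-1` _]setTI; exact: g_measurable.
exact: copies_law1 mgB.
Qed.

Lemma pair_independent_comp :
  independent_seq P (fun i => rv_pair (g \o Xs i) (Ys i)).
Proof.
move=> s B s_uniq mB; pose h (p : R * R) := (g p.1, p.2).
have mh : measurable_fun setT h.
  apply: measurable_fun_pair; last exact: measurable_snd.
  by apply: measurableT_comp => //; exact: measurable_fst.
have mhB i : measurable (h @^-1` B i).
  by rewrite -[_ @^-1` _]setTI; exact: mh.
have := XY_independent [fset x in s]%fset mhB.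
rewrite (perm_big s) /=; last first.
  by apply: uniq_perm; [exact: fset_uniq|exact: s_uniq|move=> i; rewrite inE].
suff -> : [set` [fset x in s]%fset] = [set` s] by [].
by apply/seteqP; split => i; rewrite /= inE.
Qed.

Variable H : forall n, 'M[C]_n.+1.
Hypothesis H_hadamard : forall n, complex_hadamard (H n).
Hypothesis UL : forall i, g \o Xs i \in Lfun P +oo%E.
Hypothesis VL : forall i, (Ys i : T -> R) \in Lfun P +oo%E.

(** [g] is the identity for asymptotic freeness and the additive convolution, and the fourth root
    for the multiplicative one; applying it to first coordinates keeps the pairs independent. *)
Lemma copies_limit : exists M (tau : ncstate (ncpoly C bool)),
  [/\ [/\ 0 < M, forall i, \forall t \ae P, `|g (Xs i t)| <= M &
        forall i, \forall t \ae P, `|Ys i t| <= M],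
      forall f, (joint_law (rmx_state P n)
        (diag_model (U := fun i => g \o Xs i) (V := fun i => Ys i) H UL VL n) f : C^o)
        @[n --> \oo] --> (tau f : C^o),
      free_elements tau (@ncX C bool),
      forall k, tau (ncX C true ^+ k) = (\int[P0]_t (g (X t) ^+ k))%:C &
      has_law tau (ncX C false) (distribution P0 Y)].
Proof.
have [M1 gXM] := copies_bounded gX_bounded
  (fun i => Linf_measurable (UL i)) copies_law1_comp.
have [M2 YM] := copies_bounded Y_bounded
  (fun i => Linf_measurable (VL i)) copies_law2.
pose M := `|M1| + `|M2| + 1.
have M0 : 0 < M by rewrite ltr_wpDl// addr_ge0.
have M1M : M1 <= M.
  by rewrite (le_trans (ler_norm _))// /M -addrA lerDl addr_ge0.
have M2M : M2 <= M.
  by rewrite (le_trans (ler_norm _))// /M addrAC lerDr addr_ge0.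
have [tau [tauP tau_free tauX]] := @diag_model_limit _ _ _ P
  (fun i => g \o Xs i) (fun i => Ys i) M
  (fun k => \int[P0]_t (g (X t) ^+ k)) (fun k => \int[P0]_t (Y t ^+ k))
  H UL VL (gXM _ M1M) (YM _ M2M)
  (fun i k => same_law_moment k gX_bounded (UL i) (copies_law1_comp i))
  (fun i k => same_law_moment k Y_bounded (VL i) (copies_law2 i))
  pair_independent_comp H_hadamard.
exists M, tau; split.
- split; [exact: M0|exact: gXM _ M1M|exact: YM _ M2M].
- exact: tauP.
- exact: tau_free.
- by move=> k; exact: tauX true k.
- split=> [|k]; first exact: distribution_compact_support.
  by rewrite moment_distribution//; exact: tauX false k.
Qed.

End Copies.

Section Convergence.
Context d (T : measurableType d) (R : realType) (P : probability T R).
Local Notation C := R[i].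
Variables (a : forall n, bool -> rmx P n) (tau : ncstate (ncpoly C bool)).
Hypothesis tauP : forall f,
  (joint_law (rmx_state P n) (a n) f : C^o) @[n --> \oo] --> (tau f : C^o).

Lemma joint_law_converges_in_moments (f : nat -> ncpoly C bool)
    (b : forall n, rmx P n) (rho : probability R R) :
  compactly_supported rho -> (forall k, tau (f k) = (moment rho k)%:C) ->
  (forall n k, nceval (a n) (f k) = b n ^+ k) ->
  converges_in_moments (rmx_state P) b rho.
Proof.
move=> rho_supp rho_moment fb; split => // k; rewrite -rho_moment.
have -> : (fun n => rmx_state P n (b n ^+ k) : C^o) =
    (fun n => joint_law (rmx_state P n) (a n) (f k) : C^o).
  by apply/funext => n; rewrite /joint_law fb.
exact: tauP.
Qed.

End Convergence.

(** Once a realization exists, [xget] returns a realized law and not the dummy Dirac mass. *)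
Lemma free_add_convP (R : realType) (mu nu : probability R R) :
  (exists rho, free_add_law mu nu rho) ->
  free_add_law mu nu (free_add_conv mu nu).
Proof. by move=> [rho h]; rewrite /free_add_conv; case: xgetP => // /(_ rho). Qed.

Lemma free_mul_convP (R : realType) (mu nu : probability R R) :
  (exists rho, free_mul_law mu nu rho) ->
  free_mul_law mu nu (free_mul_conv mu nu).
Proof. by move=> [rho h]; rewrite /free_mul_conv; case: xgetP => // /(_ rho). Qed.

Lemma free_add_law_supported (R : realType) (mu nu rho : probability R R) :
  free_add_law mu nu rho -> compactly_supported rho.
Proof. by move=> [A [st [phi [a [b [_ _ _ _ [_ _ []]]]]]]]. Qed.

Lemma free_mul_law_supported (R : realType) (mu nu rho : probability R R) :
  free_mul_law mu nu rho -> compactly_supported rho.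
Proof. by move=> [A [st [phi [a [b [s [_ _ _ _ [_ _ []]]]]]]]]. Qed.

Lemma pair_family_id (A : Type) (x : bool -> A) :
  pair_family (x true) (x false) = x.
Proof. by apply/funext => -[]. Qed.

Lemma sqrt_sqrtX4 (R : realType) (x : R) k : 0 <= x ->
  Num.sqrt (Num.sqrt x) ^+ (4 * k) = x ^+ k.
Proof.
by move=> x0; rewrite exprM (exprM _ 2 2) !sqr_sqrtr ?sqrtr_ge0.
Qed.

Lemma rmx_diag_sqr d (T : measurableType d) (R : realType) (P : probability T R)
    n (Z W : nat -> T -> R) (ZL : forall i, Z i \in Lfun P +oo%E)
    (WL : forall i, W i \in Lfun P +oo%E) :
  (forall i t, W i t ^+ 2 = Z i t) ->
  rmx_diag n WL * rmx_diag n WL = rmx_diag n ZL.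
Proof.
move=> WZ; apply/val_inj/funext => t; apply: etrans (mulmx_diag _ _) _.
congr diag_mx.
by apply/rowP => i; rewrite !mxE -rmorphM -expr2 WZ.
Qed.

(* N = n.+1 *)
Theorem corollary3p7 (R : realType)
  (d0 : measure_display) (T0 : measurableType d0) (P0 : probability T0 R)
  (X Y : {RV P0 >-> R})
  (d : measure_display) (T : measurableType d) (P : probability T R)
  (Xs Ys : nat -> {RV P >-> R})
  (H : forall n : nat, 'M[R[i]]_n.+1)
  (X_bounded : (X : T0 -> R) \in Lfun P0 +oo%E)
  (Y_bounded : (Y : T0 -> R) \in Lfun P0 +oo%E)
  (XY_copies : pair_copies P0 P X Y (fun i => Xs i) (fun i => Ys i))
  (XY_independent : pair_independent P (fun i => Xs i) (fun i => Ys i))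
  (H_hadamard : forall n : nat, complex_hadamard (H n)) :
  let XN n : rmx P n := rmx_diag n (copies_Linf1 XY_copies X_bounded) in
  let sqrtXN n : rmx P n :=
    rmx_diag n (fun i => Linf_sqrt (copies_Linf1 XY_copies X_bounded i)) in
  let YN n : rmx P n := rmx_diag n (copies_Linf2 XY_copies Y_bounded) in
  let HN n : rmx P n := rmx_cst P (H n) in
  let HstarN n : rmx P n := rmx_cst P ((H n) ^t*) in
  let HYHN n : rmx P n := n.+1%:R^-1 *: (HN n * YN n * HstarN n) in
  [/\ asymptotically_free (fun n => rmx_state P n)
        (fun n => pair_family (XN n) (HYHN n)),
      converges_in_moments (fun n => rmx_state P n)
        (fun n => XN n + HYHN n)
        (free_add_conv (distribution P0 X) (distribution P0 Y)) &
      (forall i, \forall t \ae P, 0 <= Xs i t) ->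
      converges_in_moments (fun n => rmx_state P n)
        (fun n => n.+1%:R^-1 *:
           (sqrtXN n * HN n * YN n * HstarN n * sqrtXN n))
        (free_mul_conv (distribution P0 X) (distribution P0 Y))].
Proof.
move=> XN sqrtXN YN HN HstarN HYHN.
have XL := copies_Linf1 XY_copies X_bounded.
have [M [tau [[M0 XM YM] tauP tau_free tauX tauY]]] :=
  copies_limit Y_bounded XY_copies XY_independent
  (@measurable_id _ _ setT) X_bounded H_hadamard
  (copies_Linf1 XY_copies X_bounded) (copies_Linf2 XY_copies Y_bounded).
have tauX_law : has_law tau (ncX R[i] true) (distribution P0 X).
  split=> [|k]; first exact: distribution_compact_support.
  by rewrite tauX moment_distribution.
split; first by exists tau; split; [exact: tauP|exact: tau_free].
  have add_law := free_add_convP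
    (limit_free_add_law M0 XM YM H_hadamard tauP tau_free tauX_law tauY).
  apply: (joint_law_converges_in_moments
    (f := fun k => (ncX R[i] true + ncX R[i] false) ^+ k) tauP).
  - exact: free_add_law_supported add_law.
  - have XY_free : free_elements tau
        (pair_family (ncX R[i] true) (ncX R[i] false)).
      by rewrite pair_family_id.
    by move=> k; exact: (free_add_law_moment XY_free tauX_law.2 tauY.2 k add_law).
  - by move=> n k; exact: nceval_addX.
move=> X_ge0; pose g (x : R) := Num.sqrt (Num.sqrt x).
(* Nonnegativity is given for the copies and passes to [X] through the common law. *)
have X_ge0' : \forall t \ae P0, 0 <= X t.
  have m0 : measurable (`[0, +oo[%classic : set R) by [].
  have X_mem := (same_law_ae (Linf_measurable X_bounded)
    (Linf_measurable (XL 0%N)) m0 (copies_law1 XY_copies 0)).2.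
  have /X_mem : \forall t \ae P, `[0, +oo[%classic (Xs 0 t).
    by apply: filterS (X_ge0 0%N) => t X0; rewrite /= in_itv/= andbT.
  by apply: filterS => t; rewrite /= in_itv/= andbT.
have gX i : g \o Xs i \in Lfun P +oo%E by apply/Linf_sqrt/Linf_sqrt.
have gX0 : g \o X \in Lfun P0 +oo%E by apply/Linf_sqrt/Linf_sqrt.
have g_measurable : measurable_fun setT g.
  by apply: measurableT_comp; apply: continuous_measurable_fun;
    exact: sqrt_continuous.
have [L [sigma [[L0 XL' YL'] sigmaP sigma_free sigmaX sigmaY]]] :=
  copies_limit Y_bounded XY_copies XY_independent
  g_measurable gX0 H_hadamard gX (copies_Linf2 XY_copies Y_bounded).
pose s := ncX R[i] true * ncX R[i] true.
have s_law : has_law sigma (s * s) (distribution P0 X).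
  split=> [|k]; first exact: distribution_compact_support.
  apply: etrans (congr1 sigma (mulr_sqr_sqrX (ncX R[i] true) k)) _.
  apply: etrans (sigmaX _) _; rewrite moment_distribution//; congr (_%:C)%C.
  apply: ae_eq_Rexpectation; [exact: LinfX gX0|exact: LinfX X_bounded|].
  by apply: filterS X_ge0' => t X0; exact: sqrt_sqrtX4.
have [rho [rho_law s_free sigmaC]] := limit_free_mul_law L0 XL' YL' H_hadamard
  sigmaP sigma_free s_law sigmaY.
have mul_law := free_mul_convP (ex_intro _ rho rho_law).
apply: (joint_law_converges_in_moments
  (f := fun k => (s * ncX R[i] false * s) ^+ k) sigmaP).
- exact: free_mul_law_supported mul_law.
- move=> k; apply: etrans (tracial_sandwich _ _ _ sigmaC) _.
  exact: (free_mul_law_moment s_free s_law.2 sigmaY.2 k mul_law).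
- move=> n k; apply: etrans (nceval_sandwich _ _ _ _) _.
  (* Since almost surely equal matrices are distinct elements of [rmx], this must hold at every
     sample point. It does, because [Num.sqrt] is nonnegative even where the copy of X is
     negative. *)
  have -> : sqrtXN n = rmx_diag n gX * rmx_diag n gX.
    apply/esym/rmx_diag_sqr => i t.
    by rewrite /= /g sqr_sqrtr ?sqrtr_ge0.
  by rewrite scaler_sandwich.
Qed.
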